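(* Fix three connected, rigid and mutually incomparable graphs $I_0,I_1,I_2$, an integer $c_{\max}>\max\{|V(I_0)|,|V(I_1)|,|V(I_2)|\}$, two distinct vertices $v^0_\ell,v^0_r$ of $I_0$, and three distinct vertices $v^i_\ell,v^i_r,v^i_p$ of $I_i$ for $i=1,2$. For $m$ a power of 2, let $G_m$ be the graph obtained from the complete binary tree with $m$ leaves as follows: replace the root by a copy of $I_0$, and replace all nodes of level $d\ge1$ by copies of $I_1$ if $d$ is odd and of $I_2$ if $d$ is even; for each tree node labelled $I_i$ with children labelled $I_j$, add an edge between $v^i_\ell$ (in the parent) and $v^j_p$ (in the left child), and an edge between $v^i_r$ (in the parent) and $v^j_p$ (in the right child); finally expand each such added edge into a simple path with $c_{\max}$ vertices on it. Let $H_m$ be the undirected complete graph on $m^6$ vertices. Then over any field, the family $(f_m)$ with $f_m(\bar Y)=f_{G_m,H_m}(\bar Y)$ is complete for $\mathsf{VP}$ under $p$-projections.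
   Context: A graph is rigid if its only homomorphism to itself is the identity; two graphs are incomparable if there is no homomorphism in either direction (homomorphism: vertex map preserving edges). For graphs $G,H$, with a variable $Y_{(a,b)}$ for each edge $(a,b)\in E(H)$, the homomorphism polynomial is $f_{G,H}(\bar Y)=\sum_{\phi}\prod_{(u,v)\in E(G)}Y_{(\phi(u),\phi(v))}$, the sum over all homomorphisms $\phi:G\to H$. $\mathsf{VP}$ is the class of $p$-families (polynomially bounded number of variables and degree) computed by polynomial-size arithmetic circuits. A polynomial $f$ is a projection of $g$ if obtained by substituting field constants or variables of $f$ for the variables of $g$; $(f_n)$ is a $p$-projection of $(g_m)$ if each $f_n$ is a projection of $g_{t(n)}$ with $t$ polynomially bounded. Complete for $\mathsf{VP}$ under $p$-projections means the family is in $\mathsf{VP}$ and every family in $\mathsf{VP}$ is a $p$-projection of it. *)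

(* Defs.v *)
From HB Require Import structures.
From mathcomp Require Import all_boot all_order all_algebra.
From mathcomp Require Import mpoly.

Set Implicit Arguments.
Unset Strict Implicit.
Unset Printing Implicit Defensive.

Import GRing.Theory.
Local Open Scope ring_scope.

Definition simple_graph (V : finType) (e : rel V) :=
  ssrbool.symmetric e /\ ssrbool.irreflexive e.

Definition is_hom (V W : finType) (eV : rel V) (eW : rel W) (phi : V -> W) :=
  forall x y, eV x y -> eW (phi x) (phi y).

Definition homb (V W : finType) (eV : rel V) (eW : rel W) (phi : {ffun V -> W}) :=
  [forall x, [forall y, eV x y ==> eW (phi x) (phi y)]].

Definition rigid (V : finType) (e : rel V) :=
  forall phi : V -> V, is_hom e e phi -> forall x, phi x = x.

Definition incomparable (V W : finType) (eV : rel V) (eW : rel W) :=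
  (forall phi : V -> W, ~ is_hom eV eW phi) /\ (forall psi : W -> V, ~ is_hom eW eV psi).

Definition connected (V : finType) (e : rel V) := forall x y : V, connect e x y.

(* Homomorphism polynomial for undirected G, H: one variable per       *)
(* unordered pair {a,b} of vertices of H (indexed by the ordered pair   *)
(* with smaller rank first; the variables for non-edges of H never      *)
(* occur), one factor per undirected edge {u,v} of G.                   *)

Definition uvar (W : finType) (a b : W) : 'I_#|{: W * W}| :=
  if (enum_rank a <= enum_rank b)%N then enum_rank (a, b) else enum_rank (b, a).

Definition hom_poly (F : ringType) (V W : finType) (eV : rel V) (eW : rel W)
  : {mpoly F[#|{: W * W}|]} :=
  \sum_(phi : {ffun V -> W} | homb eV eW phi)
     \prod_(p : V * V | eV p.1 p.2 && (enum_rank p.1 < enum_rank p.2)%N)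
        'X_(uvar (phi p.1) (phi p.2)).

(* Arithmetic circuits as straight-line programs with fan-in 2:        *)
(* gate number i may use the values of gates j < i; the output is the *)
(* last gate; size = number of gates.                                  *)

Inductive gate (F : Type) (n : nat) :=
| GVar of 'I_n
| GConst of F
| GAdd of nat & nat
| GMul of nat & nat.

Definition gate_val (F : ringType) (n : nat) (acc : seq {mpoly F[n]}) (g : gate F n)
  : {mpoly F[n]} :=
  match g with
  | GVar i => 'X_i
  | GConst c => c%:MP
  | GAdd j k => acc`_j + acc`_k
  | GMul j k => acc`_j * acc`_k
  end.

Definition gate_wf (F : Type) (n : nat) (k : nat) (g : gate F n) : bool :=
  match g with
  | GAdd j l | GMul j l => (j < k)%N && (l < k)%N
  | _ => true
  end.

Fixpoint slp_wf (F : Type) (n : nat) (k : nat) (prog : seq (gate F n)) : bool :=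
  match prog with
  | [::] => true
  | g :: p => gate_wf k g && slp_wf k.+1 p
  end.

Definition slp_vals (F : ringType) (n : nat) (prog : seq (gate F n)) : seq {mpoly F[n]} :=
  foldl (fun acc g => rcons acc (gate_val acc g)) [::] prog.

Definition computes (F : ringType) (n : nat) (prog : seq (gate F n)) (f : {mpoly F[n]}) :=
  [/\ (0 < size prog)%N, slp_wf 0 prog & last 0 (slp_vals prog) = f].

Definition poly_bounded (t : nat -> nat) := exists c : nat, forall n, (t n <= n ^ c + c)%N.

Record pfamily (F : ringType) := PFam {
  pf_nv : nat -> nat;
  pf_poly : forall n : nat, {mpoly F[pf_nv n]} }.

Definition is_pfamily (F : ringType) (f : pfamily F) :=
  poly_bounded (pf_nv f) /\ poly_bounded (fun n => msize (pf_poly f n)).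

Definition in_VP (F : ringType) (f : pfamily F) :=
  is_pfamily f /\
  exists s : nat -> nat, poly_bounded s /\
    forall n, exists prog : seq (gate F (pf_nv f n)),
      (size prog <= s n)%N /\ computes prog (pf_poly f n).

Definition subst_var (F : ringType) (n : nat) (x : F + 'I_n) : {mpoly F[n]} :=
  match x with inl c => c%:MP | inr i => 'X_i end.

Definition is_projection (F : ringType) (n m : nat) (f : {mpoly F[n]}) (g : {mpoly F[m]}) :=
  exists sigma : 'I_m -> F + 'I_n,
    f = comp_mpoly [tuple subst_var (sigma j) | j < m] g.

Definition p_projection (F : ringType) (f g : pfamily F) :=
  exists t : nat -> nat, poly_bounded t /\
    forall n, is_projection (pf_poly f n) (pf_poly g (t n)).

Definition VP_complete (F : ringType) (g : pfamily F) :=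
  in_VP g /\ forall f : pfamily F, in_VP f -> p_projection f g.

(* The graphs G_m.  Tree nodes are numbered in heap order 1 .. 2m-1    *)
(* (root 1, children of k are 2k (left) and 2k+1 (right)); node k has  *)
(* level trunc_log 2 k.  Node k carries a copy of I_0 (level 0), I_1   *)
(* (odd level) or I_2 (even level >= 2).  For every non-root node k,   *)
(* the parent-child edge is replaced by a path with cmax vertices      *)
(* (endpoints included), i.e. cmax - 2 new internal vertices.          *)

Section Construction.
Variables (V0 V1 V2 : finType) (e0 : rel V0) (e1 : rel V1) (e2 : rel V2).
Variables (vl0 vr0 : V0) (vl1 vr1 vp1 : V1) (vl2 vr2 vp2 : V2).
Variables (cmax m : nat).

Definition gS : finType := (V0 + (V1 + V2))%type.

Definition gtype (k : nat) : nat :=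
  let d := trunc_log 2 k in if d == 0%N then 0%N else if odd d then 1%N else 2%N.

Definition gtag (s : gS) : nat :=
  match s with inl _ => 0%N | inr (inl _) => 1%N | inr (inr _) => 2%N end.

Definition geS (s t : gS) : bool :=
  match s, t with
  | inl a, inl b => e0 a b
  | inr (inl a), inr (inl b) => e1 a b
  | inr (inr a), inr (inr b) => e2 a b
  | _, _ => false
  end.

Definition glv (i : nat) : gS :=
  if i == 0%N then inl vl0 else if i == 1%N then inr (inl vl1) else inr (inr vl2).
Definition grv (i : nat) : gS :=
  if i == 0%N then inl vr0 else if i == 1%N then inr (inl vr1) else inr (inr vr2).
(* I_0 has no vertex v_p; the value for i = 0 is never used. *)
Definition gpv (i : nat) : gS :=
  if i == 0%N then inl vl0 else if i == 1%N then inr (inl vp1) else inr (inr vp2).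

Definition gq : nat := (cmax - 2)%N.

Definition graw : finType := (('I_(2 * m) * gS) + ('I_(2 * m) * 'I_gq))%type.

Definition gvalid (x : graw) : bool :=
  match x with
  | inl (k, s) => (1 <= k)%N && (gtag s == gtype k)
  | inr (k, j) => (2 <= k)%N
  end.

(* t-th vertex (t = 0 .. gq+1) of the path from the parent of k to k. *)
Definition gpath (k : 'I_(2 * m)) (t : nat) : graw :=
  let child := inl (k, gpv (gtype k)) in
  if t == 0%N then
    inl (insubd k k./2, (if odd k then grv else glv) (gtype k./2))
  else if (t <= gq)%N then
    match insub (t.-1) with Some j => inr (k, j) | None => child end
  else child.

Definition grawE (x y : graw) : bool :=
  match x, y with
  | inl (k, s), inl (k', s') => (k == k') && geS s s'
  | _, _ => false
  end
  || [exists k : 'I_(2 * m), [exists t : 'I_gq.+1,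
        (2 <= k)%N &&
        (((x == gpath k t) && (y == gpath k t.+1)) ||
         ((y == gpath k t) && (x == gpath k t.+1)))]].

Definition GV : finType := {x : graw | gvalid x}.

Definition GE : rel GV := fun x y => grawE (val x) (val y).

End Construction.

Definition KE (N : nat) : rel 'I_N := fun a b => a != b.

Definition pow2up (n : nat) : nat := (2 ^ up_log 2 n)%N.

(* Main.v *)
(* Lower bound.  A polynomial-size circuit of polynomial degree is turned into O(log n) layers
   q_g = (sum_h w_h p_h)(sum_h w'_h p_h) of polynomial width, with weights that are variables or
   constants, by splitting gates into homogeneous parts and using the gate quotients of
   Valiant-Skyum-Berkowitz-Rackoff.  Place one gadget copy per layer and gate, joined by paths
   carrying the weights.  A gadget has fewer than cmax vertices, so the image of a homomorphism
   meets at most one copy; folding the incident paths back onto that copy and using rigidity and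
   incomparability shows that it is the canonical embedding.  A walk of length cmax - 1 between
   distinct copies must follow one connecting path.  Hence weighted homomorphisms of G_m are
   exactly the parse trees of the layered circuit.

   Upper bound.  The sum over homomorphisms factors along the tree, with one state per map of a
   gadget; gadgets and paths have constant size, so there are polynomially many states. *)
Require Import Defs.
From HB Require Import structures.
From mathcomp Require Import all_boot all_order all_algebra.
From mathcomp Require Import mpoly zify.

Set Implicit Arguments.
Unset Strict Implicit.
Unset Printing Implicit Defensive.

Import GRing.Theory.

(** * Polynomially bounded functions *)

(** Both bounds rest on one formula, [tree_of_graph_sum], for arbitrary symmetric edge weights on
    the target. It sums over all maps, a non-edge being an edge of weight 0, so a complete graph
    with suitable weights simulates every graph on as many vertices.

    The reduction is shaped by how little freedom the pattern leaves. In G_m all leaves have the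
    same depth, every inner node has two children, and a weight has to be a single constant or
    variable. Circuits are therefore levelled exactly, every gate is a product of two sums, and an
    entry equal to 1 is carried from layer to layer so that values can be passed on unchanged.

    The level of a copy is not visible in its gadget beyond a parity. It is recovered from the root:
    I_0 occurs at level 0 only, consecutive levels carry different gadgets, so that parent and child
    lie in different copies, and the vertices v_l, v_r and v_p orient the connecting paths
    downwards, so that each tree edge descends by exactly one level. *)

Section PolynomialBounds.
Implicit Types t u : nat -> nat.

(** This form is closed under sums and products without case distinctions at n = 0 and n = 1, where
    [n ^ c + c] is awkward. *)
Definition polyb t := exists C k, forall n, t n <= C * n.+1 ^ k.

Lemma polyb_le t u : (forall n, t n <= u n) -> polyb u -> polyb t.
Proof. by move=> tu [C [k H]]; exists C, k => n; apply: leq_trans (tu n) (H n). Qed.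

Lemma polyb_const c : polyb (fun=> c).
Proof. by exists c, 0 => n; rewrite muln1. Qed.

Lemma polyb_id : polyb id.
Proof. by exists 1, 1 => n; rewrite mul1n expn1. Qed.

Lemma polyb_add t u : polyb t -> polyb u -> polyb (fun n => t n + u n).
Proof.
move=> [C [k Ht]] [D [l Hu]]; exists (C + D), (k + l) => n.
rewrite mulnDl; apply: leq_add.
  by apply: leq_trans (Ht n) _; rewrite leq_mul2l leq_pexp2l ?orbT // leq_addr.
by apply: leq_trans (Hu n) _; rewrite leq_mul2l leq_pexp2l ?orbT // leq_addl.
Qed.

Lemma polyb_mul t u : polyb t -> polyb u -> polyb (fun n => t n * u n).
Proof.
move=> [C [k Ht]] [D [l Hu]]; exists (C * D), (k + l) => n.
by rewrite expnD mulnACA leq_mul.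
Qed.

Lemma polyb_exp t e : polyb t -> polyb (fun n => t n ^ e).
Proof.
move=> Ht; elim: e => [|e IH]; first exact: polyb_const.
by apply: polyb_le (polyb_mul Ht IH) => n; rewrite expnS.
Qed.

Lemma polyb_of_poly_bounded t : poly_bounded t -> polyb t.
Proof.
case=> c H; apply: polyb_le H _.
by apply: polyb_add (polyb_const c); apply: polyb_exp polyb_id.
Qed.

(** For n >= 2 one has C <= 2^C <= n^C and (n + 1)^k <= n^(2k), which gives the exponent; the terms
    [C * 2 ^ k] and [C] cover n = 1 and n = 0. *)
Lemma poly_bounded_of_polyb t : polyb t -> poly_bounded t.
Proof.
case=> C [k H]; exists (2 * k + C * 2 ^ k + C) => n; apply: leq_trans (H n) _.
case: n => [|[|n]].
- by rewrite exp1n muln1; lia.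
- by rewrite exp1n; lia.
apply: leq_trans (leq_addr _ _).
have -> : 2 * k + C * 2 ^ k + C = C + 2 * k + C * 2 ^ k by lia.
apply: (@leq_trans (n.+2 ^ (C + 2 * k))); last by rewrite leq_pexp2l // leq_addr.
have exp_le a b e : a <= b -> a ^ e <= b ^ e by case: e => // e; rewrite leq_exp2r.
rewrite expnD; apply: leq_mul.
  by apply: leq_trans (ltnW (ltn_expl C (isT : 1 < 2))) _; apply: exp_le.
by rewrite expnM; apply: exp_le; rewrite -mulnn; nia.
Qed.

Lemma exp2_up_log n : 2 ^ up_log 2 n <= 2 * n + 1.
Proof.
case: n => [|[|n]] //; have := @up_log_gtn 2 n.+2 isT isT.
have : 0 < up_log 2 n.+2 by rewrite up_log_gt0.
by case: (up_log 2 n.+2) => // k _ /=; rewrite expnS; lia.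
Qed.

Lemma polyb_exp2_up_log t : polyb t -> polyb (fun n => 2 ^ up_log 2 (t n)).
Proof.
move=> Ht; apply: polyb_le (fun n => exp2_up_log (t n)) _.
by apply: polyb_add (polyb_const 1); apply: polyb_mul (polyb_const 2) Ht.
Qed.

End PolynomialBounds.

(** The 3 per factor: a variable has [msize] 2, and the general bound [msizeM_le] loses one more. *)
Lemma msize_prod_var (F : fieldType) (n : nat) (T : finType) (Q : pred T) (f : T -> 'I_n) :
  msize (\prod_(t | Q t) ('X_(f t) : {mpoly F[n]}))%R <= 1 + 3 * #|T|.
Proof.
rewrite -[index_enum T]enumT cardT; elim: (enum T) => [|t r IH] /=.
  by rewrite big_nil msize1.
rewrite big_cons; case: ifP => _; last by apply: leq_trans IH _; lia.
apply: leq_trans (msizeM_le _ _) _; rewrite msizeX mdeg1.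
by apply: leq_ltn_trans (leq_add (leqnn 2) IH) _; lia.
Qed.

Lemma msize_hom_poly (F : fieldType) (V W : finType) (e : rel V) (e' : rel W) :
  msize (hom_poly F e e') <= 1 + 3 * (#|V| * #|V|).
Proof.
apply: leq_trans (msize_sum _ _ _) _; apply/bigmax_leqP => phi _.
by apply: leq_trans (msize_prod_var _ _ _) _; rewrite card_prod.
Qed.

Lemma uvarC (W : finType) (a b : W) : uvar a b = uvar b a.
Proof.
rewrite /uvar; have [ab|ba] := leqP (enum_rank a) (enum_rank b).
  rewrite [in RHS]leq_eqVlt; have [E|_] := eqVneq (enum_rank b : nat) (enum_rank a).
    by have /enum_rank_inj -> : enum_rank b = enum_rank a by apply: ord_inj.
  by rewrite /= ltnNge ab.
by rewrite ltnW.
Qed.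

(** * Gadget homomorphisms into the target graph *)

Definition ltype (d : nat) : nat := if d == 0 then 0 else if odd d then 1 else 2.

Lemma ltype_lt3 d : ltype d < 3.
Proof. by rewrite /ltype; case: ifP => // _; case: ifP. Qed.

Lemma ltypeS_neq0 d : ltype d.+1 != 0.
Proof. by rewrite /ltype /=; case: ifP. Qed.

(** This is what keeps the images of a parent and its child in different copies. *)
Lemma ltypeS_neq d : ltype d.+1 != ltype d.
Proof. by rewrite /ltype; case: d => //= d; rewrite negbK; case: (odd d). Qed.

(* The three gadgets form one graph on S whose components are the fibres of tag; att false i,
   att true i and pv i are the vertices v_l, v_r and v_p of I_i. *)
Record gadgets (S : finType) (e : rel S) (tag : S -> nat) (att : bool -> nat -> S)
    (pv : nat -> S) (gq : nat) : Prop := Gadgets {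
  gd_sym : ssrbool.symmetric e;
  gd_irr : irreflexive e;
  gd_tag : forall x y, e x y -> tag x = tag y;
  gd_conn : forall x y, tag x = tag y -> connect e x y;
  gd_rigid : forall i j (phi : S -> S), i < 3 -> j < 3 ->
    (forall x y, tag x = i -> e x y -> e (phi x) (phi y)) ->
    (forall x, tag x = i -> tag (phi x) = j) ->
    forall x, tag x = i -> phi x = x;
  gd_lt3 : forall x, tag x < 3;
  gd_small : forall i, #|[pred x | tag x == i]| < gq.+2;
  gd_att : forall b i, i < 3 -> tag (att b i) = i;
  gd_pv : forall i, i < 3 -> tag (pv i) = i;
  gd_att_inj : forall b b' i, i < 3 -> att b i = att b' i -> b = b';
  gd_att_pv : forall b i, i < 3 -> i != 0 -> att b i != pv i;
  gd_gq : 0 < gq }.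

Section Gadgets.
Variables (S : finType) (e : rel S) (tag : S -> nat) (att : bool -> nat -> S).
Variables (pv : nat -> S) (gq : nat).
Hypothesis gd : gadgets e tag att pv gq.

(** Each component contains the distinct vertices [att true i] and [att false i]; a path from x to
    one of them other than x begins with the required edge. *)
Lemma gadget_neighbour x : exists y, e x y.
Proof.
have [b nb] : exists b, att b (tag x) != x.
  have [E|] := eqVneq (att true (tag x)) x; last by exists true.
  exists false; apply/eqP => E'.
  by have := gd_att_inj gd (gd_lt3 gd x) (etrans E (esym E')).
have /connectP[[|y p]] := gd_conn gd (esym (gd_att gd b (gd_lt3 gd x))).
  by move=> _ /= E; rewrite E eqxx in nb.
by move=> /= /andP[xy _] _; exists y.
Qed.

(* Otherwise u could be folded onto another neighbour of v, or swapped with v. *)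
Lemma gadget_mindeg2 u v : exists2 w, e u w & w != v.
Proof.
have e_sym := gd_sym gd.
have [w uw] := gadget_neighbour u; have [E|] := eqVneq w v; last by exists w.
subst w.
have [/existsP[w /andP[w1 w2]]|/existsPn H] := boolP [exists w, e u w && (w != v)].
  by exists w.
have uniq_u w : e u w -> w = v.
  by move=> uw'; apply/eqP; have := H w; rewrite uw' /= negbK.
have uv_ne : (u == v) = false by apply/eqP => E; move: uw; rewrite E (gd_irr gd).
have [/existsP[z /andP[vz zu]]|/existsPn H2] := boolP [exists z, e v z && (z != u)].
  pose phi x := if x == u then z else x.
  suff /(_ u erefl) : forall x, tag x = tag u -> phi x = x.
    by rewrite /phi eqxx => E; rewrite E eqxx in zu.
  apply: (gd_rigid gd (gd_lt3 gd u) (gd_lt3 gd u)) => [x y _|x] xy; rewrite /phi.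
    case: eqP => [Ex|nx]; case: eqP => [Ey|ny] //.
    - by move: xy; rewrite Ex Ey (gd_irr gd).
    - by move: xy; rewrite Ex => /uniq_u ->; rewrite e_sym.
    - by move: xy; rewrite Ey e_sym => /uniq_u ->.
  by case: eqP => // _; rewrite (gd_tag gd uw) (gd_tag gd vz).
have uniq_v w : e v w -> w = u.
  by move=> vw; apply/eqP; have := H2 w; rewrite vw /= negbK.
pose phi x := if x == u then v else if x == v then u else x.
suff /(_ u erefl) : forall x, tag x = tag u -> phi x = x.
  by rewrite /phi eqxx => E; rewrite E eqxx in uv_ne.
apply: (gd_rigid gd (gd_lt3 gd u) (gd_lt3 gd u)) => [x y _|x] xy; rewrite /phi.
  have [Ex|nx] := eqVneq x u.
    by move: xy; rewrite Ex => /uniq_u ->; rewrite eq_sym uv_ne eqxx e_sym.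
  have [Ex|nx'] := eqVneq x v.
    by move: xy; rewrite Ex => /uniq_v ->; rewrite eqxx.
  have [Ey|ny] := eqVneq y u; first by move: xy; rewrite Ey e_sym => /uniq_u Ex; rewrite Ex eqxx in nx'.
  have [Ey|ny'] := eqVneq y v; first by move: xy; rewrite Ey e_sym => /uniq_v Ex; rewrite Ex eqxx in nx.
  by [].
case: eqP => [_|_]; first exact: esym (gd_tag gd uw).
by case: eqP.
Qed.

(** The freedom to avoid [v] refutes, in [gadget_hom], images at odd positions inside a path. *)
Lemma gadget_avoid v : exists nu : S -> S, forall u, e u (nu u) /\ nu u != v.
Proof.
apply: (@fin_all_exists S (fun _ => S) (fun u w => e u w /\ w != v)) => u.
by have [w] := gadget_mindeg2 u v; exists w.
Qed.

(** Discrete intermediate values: along a path from x to y, f would take all gq + 2 values 0, ...,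
    gq + 1, more than the component has vertices. *)
Lemma lipschitz_class i (f : S -> nat) x y : tag x = i -> tag y = i ->
  (forall x y, tag x = i -> e x y -> f y <= (f x).+1) -> f x = 0 -> f y != gq.+1.
Proof.
move=> tx ty lip fx; apply/eqP => fy.
have ivt v : v <= gq.+1 -> exists2 z, tag z = i & f z = v.
  move=> vq; have /connectP[p pp yp] := gd_conn gd (etrans tx (esym ty)).
  have le0 : f x <= v by rewrite fx.
  have lev : v <= f (last x p) by rewrite -yp fy.
  elim: p x tx pp {yp fx} le0 lev => [|w p IH] x tx /=.
    by move=> _ l1 l2; exists x => //; apply/eqP; rewrite eqn_leq l1.
  case/andP=> xw pw l1 l2; have [fw|fw] := leqP (f w) v.
    by apply: (IH w) => //; rewrite -(gd_tag gd xw).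
  by exists x => //; apply/eqP; rewrite eqn_leq l1 -ltnS (leq_trans fw) // lip.
have /leq_trans/(_ (gd_small gd i)) : gq.+2 <= #|[pred x | tag x == i]|; last by rewrite ltnn.
have [g Hg] : exists g : 'I_gq.+2 -> S, forall v, tag (g v) = i /\ f (g v) = v.
  apply: (@fin_all_exists 'I_gq.+2 (fun _ => S) (fun v z => tag z = i /\ f z = v)) => v.
  by have [|z tz fz] := ivt v; [exact: leq_ord v | exists z].
have gi : injective g by move=> v w E; apply: val_inj; rewrite /= -(Hg v).2 -(Hg w).2 E.
rewrite -[X in X <= _]card_ord -(card_codom gi); apply: subset_leq_card.
by apply/subsetP => _ /codomP[v ->]; rewrite inE (Hg v).1.
Qed.

(** * The target graph, its gadget homomorphisms and its walks *)

Section TargetGraph.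
Variables (I : finType) (g0 : I) (L r : nat).

(* Copies of gadgets, interiors of the connecting paths, and isolated vertices: the padding
   makes the vertex set equipotent with that of the complete graph. *)
Definition jvert : finType :=
  (('I_L.+1 * I) * S + ('I_L * bool * I * I) * 'I_gq + 'I_r)%type.
Definition copy c s : jvert := inl (inl (c, s)).
Definition pint p j : jvert := inl (inr (p, j)).

(** Path [(d, b, g, h)] runs from [att b] in copy (d, g) to [pv] in copy (d + 1, h), so [b] tells
    left from right. Arcs on it point away from the root level. *)
Definition first_arc (c : 'I_L.+1 * I) s (p : 'I_L * bool * I * I) (j : nat) : bool :=
  let: (d, b, g, h) := p in [&& c.1 == d :> nat, c.2 == g, s == att b (ltype d) & j == 0].
Definition last_arc (c : 'I_L.+1 * I) s (p : 'I_L * bool * I * I) (j : nat) : bool :=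
  let: (d, b, g, h) := p in
  [&& c.1 == d.+1 :> nat, c.2 == h, s == pv (ltype d.+1) & j.+1 == gq].

(** A copy has all of [S] as vertices, but only the component belonging to its level carries
    edges. *)
Definition jarc (x y : jvert) : bool :=
  match x, y with
  | inl (inl (c, s)), inl (inl (c', s')) => [&& c == c', tag s == ltype c.1 & e s s']
  | inl (inl (c, s)), inl (inr (p, j)) => first_arc c s p j
  | inl (inr (p, j)), inl (inl (c, s)) => last_arc c s p j
  | inl (inr (p, j)), inl (inr (p', j')) => (p == p') && (j' == j.+1 :> nat)
  | _, _ => false
  end.
Definition jadj x y := jarc x y || jarc y x.

Section AroundCopy.
Variable c : 'I_L.+1 * I.

Definition starts (p : 'I_L * bool * I * I) :=
  let: (d, b, g, h) := p in (c.1 == d :> nat) && (c.2 == g).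
Definition ends (p : 'I_L * bool * I * I) :=
  let: (d, b, g, h) := p in (c.1 == d.+1 :> nat) && (c.2 == h).

(** Distance from the copy [c], contracted to a point, capped at gq + 1, the length of a connecting
    path. *)
Definition cdist (x : jvert) : nat :=
  match x with
  | inl (inl (c', _)) => if c' == c then 0 else gq.+1
  | inl (inr (p, j)) => if starts p then j.+1 else if ends p then gq - j else gq.+1
  | inr _ => gq.+1
  end.

Lemma starts_ends p : starts p -> ends p = false.
Proof.
case: p => [[[d b] g] h] /= /andP[/eqP -> _].
by rewrite (ltn_eqF (ltnSn d)).
Qed.

Lemma cdist_arc x y : jarc x y -> cdist x <= (cdist y).+1 /\ cdist y <= (cdist x).+1.
Proof.
case: x y => [[[c' s]|[p j]]|x] [[[c'' s']|[p' j']]|y] //=.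
- by case/and3P=> /eqP -> _ _.
- case: p' => [[[d b] g] h] /and4P[/eqP cd /eqP cg _ /eqP j0] /=.
  rewrite j0 subn0; have -> : (c' == c) = (c.1 == d :> nat) && (c.2 == g).
    by rewrite -cd -cg eq_sym -pair_eqE /=.
  by case: ifP => // _; case: ifP => _; split=> //; do 2?apply: leqW.
- case: p => [[[d b] g] h] /and4P[/eqP cd /eqP cg _ /eqP jq] /=.
  have -> : (c'' == c) = (c.1 == d.+1 :> nat) && (c.2 == h).
    by rewrite -cd -cg eq_sym -pair_eqE /=.
  case: ifP => [st|_].
    by have /= -> := @starts_ends (d, b, g, h) st; rewrite jq; split => //; exact: leqW.
  case: ifP => _; last by split; rewrite ?leqnn.
  by rewrite leq_subLR addn1 jq.
case/andP=> /eqP <- /eqP jj; rewrite jj; case: ifP => _; first by split; rewrite // leqW.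
case: ifP => _; last by split.
have := ltn_ord j'; rewrite jj => lt.
by rewrite subnS; split; [exact: leqSpred | exact: leqW (leq_pred _)].
Qed.

Lemma cdist_adj x y : jadj x y -> cdist y <= (cdist x).+1.
Proof. by case/orP=> /cdist_arc[]. Qed.

(** The end of the path that lies in [c]; for a path not incident with [c], an arbitrary vertex of
    the right component. *)
Definition anchor (p : 'I_L * bool * I * I) : S :=
  let: (d, b, g, h) := p in
  if starts p then att b (ltype c.1) else if ends p then pv (ltype c.1) else att true (ltype c.1).
(** Odd distance from the anchor. On a path not incident with [c] any alternating labelling
    serves. *)
Definition parity p (j : nat) : bool :=
  if starts p then ~~ odd j else if ends p then odd (gq - j) else odd j.

Lemma parityS p j : j.+1 < gq -> parity p j.+1 = ~~ parity p j.
Proof.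
rewrite /parity => jq; case: ifP => //= _; case: ifP => // _.
by rewrite !oddB /= ?addbN // ltnW // ltnW.
Qed.

Lemma tag_anchor p : tag (anchor p) = ltype c.1.
Proof.
case: p => [[[d b] g] h] /=; do 2?case: ifP => _;
  by rewrite ?(gd_att gd) ?(gd_pv gd) ?ltype_lt3.
Qed.

Variable nu : S -> S.
Hypothesis Hnu : forall u, e u (nu u).

(* Fold every path back onto an edge at its end in c. *)
Definition fold_copy (x : jvert) : S :=
  match x with
  | inl (inl (_, s)) => if tag s == ltype c.1 then s else att true (ltype c.1)
  | inl (inr (p, j)) => if parity p j then nu (anchor p) else anchor p
  | inr _ => att true (ltype c.1)
  end.

Definition near_copy (x : jvert) : bool := if x is inl (inl (c', _)) then c' == c else true.

Lemma tag_fold_copy x : tag (fold_copy x) = ltype c.1.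
Proof.
case: x => [[[c' s]|[p j]]|x] /=; rewrite ?(gd_att gd) ?ltype_lt3 //.
  by case: eqP => //; rewrite ?(gd_att gd) ?ltype_lt3.
by case: ifP => _; rewrite -?(gd_tag gd (Hnu _)) tag_anchor.
Qed.

Lemma arc_pint_copy p j s : jarc (pint p j) (copy c s) ->
  [/\ parity p j, anchor p = s & tag s = ltype c.1].
Proof.
case: p => [[[d b] g] h] /and4P[cd ch /eqP -> /eqP jq].
have en : ends (d, b, g, h) by rewrite /= cd.
have st : starts (d, b, g, h) = false by apply: contraTF en => /starts_ends ->.
have gj : gq - j = 1 by rewrite -{1}jq subSn // subnn.
rewrite /parity /anchor st en gj -(eqP cd); split => //.
by rewrite (gd_pv gd) ?ltype_lt3.
Qed.

Lemma arc_copy_pint p j s : jarc (copy c s) (pint p j) ->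
  [/\ parity p j, anchor p = s & tag s = ltype c.1].
Proof.
case: p => [[[d b] g] h] /and4P[cd ch /eqP -> /eqP jq].
have st : starts (d, b, g, h) by rewrite /= cd.
rewrite /parity /anchor st jq -(eqP cd); split => //.
by rewrite (gd_att gd) ?ltype_lt3.
Qed.

(** Along a path the fold alternates between [anchor p] and [nu (anchor p)], and the path vertex
    next to [c] is at odd distance from the anchor, so every edge lands on an edge. *)
Lemma fold_copy_arc x y : jarc x y -> near_copy x -> near_copy y ->
  e (fold_copy x) (fold_copy y).
Proof.
case: x y => [[[c' s]|[p j]]|x] [[[c'' s']|[p' j']]|y] //.
- move=> /= /and3P[_ ts ss'] /eqP E _; subst c'.
  by rewrite -(gd_tag gd ss') ts.
- move=> xy /eqP E _; subst c'.
  have [pa an ts] := arc_copy_pint xy.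
  by rewrite /= pa ts eqxx an.
- move=> xy _ /eqP E; subst c''.
  have [pa an ts] := arc_pint_copy xy.
  by rewrite /= pa ts eqxx an (gd_sym gd).
- move=> /= /andP[/eqP <- /eqP jj] _ _; rewrite jj parityS ?jj -?jj //.
  by case: (parity p j); rewrite //= (gd_sym gd).
Qed.

Lemma fold_copy_adj x y : jadj x y -> near_copy x -> near_copy y ->
  e (fold_copy x) (fold_copy y).
Proof.
by case/orP=> a nx ny; [|rewrite (gd_sym gd)]; exact: fold_copy_arc.
Qed.

End AroundCopy.

Lemma adj_copy_tag c s y : jadj (copy c s) y -> tag s = ltype c.1.
Proof.
case: y => [[[c' s']|[p j]]|y]; rewrite /jadj //.
- case/orP=> /and3P[/eqP E /eqP t ss'] //.
  by rewrite -(gd_tag gd ss') t E.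
- by case/orP=> [/arc_copy_pint[]|/arc_pint_copy[]].
Qed.

(** The fold after [phi] is the identity for every choice of neighbours [nu]. Hence no x is mapped
    to an odd position inside a path, since [nu] may avoid x. An even position is excluded too: its
    neighbours in the target are odd positions, and it is never adjacent to [c]. *)
Lemma gadget_hom i (phi : S -> jvert) : i < 3 ->
  (forall x y, tag x = i -> e x y -> jadj (phi x) (phi y)) ->
  exists2 c : 'I_L.+1 * I, ltype c.1 = i & forall x, tag x = i -> phi x = copy c x.
Proof.
move=> i3 hom.
have [c near] : exists c, forall x, tag x = i -> near_copy c (phi x).
  pose P x := (tag x == i) && (if phi x is inl (inl _) then true else false).
  have [/existsP[x /andP[/eqP tx]]|/existsPn no] := boolP [exists x, P x]; last first.
    (* An image that meets no copy is near every copy, so any one may be taken. *)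
    exists (ord0, g0) => x tx; have := no x; rewrite /P tx eqxx /=.
    by case: (phi x) => [[]|].
  case Ex: (phi x) => [[[c s]|]|] // _; exists c => y ty.
  have : cdist c (phi y) != gq.+1.
    apply: (lipschitz_class (f := fun z => cdist c (phi z)) tx ty) => [z w tz zw|].
      by apply: cdist_adj; apply: hom.
    by rewrite Ex /= eqxx.
  by case: (phi y) => [[[c' s']|]|] //=; case: ifP => //; rewrite eqxx.
have foldK nu : (forall u, e u (nu u)) -> forall x, tag x = i -> fold_copy c nu (phi x) = x.
  move=> Hnu; apply: (gd_rigid gd i3 (ltype_lt3 c.1) (phi := fun x => fold_copy c nu (phi x))).
    move=> x y tx xy; apply: fold_copy_adj => //; rewrite ?near //; first exact: hom.
    by rewrite -(gd_tag gd xy).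
  by move=> x _; apply: tag_fold_copy.
have noodd x p j : tag x = i -> phi x = pint p j -> ~~ parity c p j.
  move=> tx Ex; apply/negP => pa; have [nu Hnu] := gadget_avoid x.
  have := foldK nu (fun u => (Hnu u).1) x tx; rewrite Ex /= pa => E.
  by have := (Hnu (anchor c p)).2; rewrite E eqxx.
have onto x : tag x = i -> exists s, phi x = copy c s.
  move=> tx; have [y xy] := gadget_neighbour x.
  have ty : tag y = i by rewrite -(gd_tag gd xy).
  have := hom x y tx xy; have := near x tx; have := near y ty.
  case Ex: (phi x) => [[[c' s]|[p j]]|z] /=; first by move=> _ /eqP <- _; exists s.
    have pF := noodd _ _ _ tx Ex.
    case Ey: (phi y) => [[[c' s]|[p' j']]|z'] //=.
    - move=> /eqP E _; subst c'.
      by case/orP=> [/arc_pint_copy[pa]|/arc_copy_pint[pa]]; rewrite pa in pF.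
    - have pF' := noodd _ _ _ ty Ey.
      move=> _ _ /orP[]/andP[/eqP E /eqP jj]; subst p'.
        by move: pF'; rewrite jj parityS -?jj // negbK (negbTE pF).
      by move: pF; rewrite jj parityS -?jj // negbK (negbTE pF').
  by rewrite /jadj; case: (phi y) => [[[c' s]|[p' j']]|z'].
(* From here on any neighbour function will do; the avoided vertex is arbitrary. *)
have [nu Hnu] := gadget_avoid (att true 0).
exists c.
  have ta := gd_att gd true i3.
  by rewrite -(tag_fold_copy c (fun u => (Hnu u).1) (phi (att true i))) foldK // => u; case: (Hnu u).
move=> x tx; have [s Es] := onto x tx.
have [y xy] := gadget_neighbour x.
have /adj_copy_tag ts : jadj (copy c s) (phi y) by rewrite -Es; apply: hom.
have := foldK nu (fun u => (Hnu u).1) x tx.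
by rewrite Es /= ts eqxx => ->.
Qed.

(** The distance from [c] grows by at most one per step and has to reach gq + 1 in gq + 1 steps, so
    [cdist c (x t) = t] throughout: the walk can neither linger in a copy nor turn back. *)
Lemma walk_copies c c' b s (x : nat -> jvert) : c' != c ->
  x 0 = copy c (att b (ltype c.1)) -> x gq.+1 = copy c' s ->
  (forall t, t <= gq -> jadj (x t) (x t.+1)) ->
  exists2 d : 'I_L, d = c.1 :> nat & [/\ c'.1 = d.+1 :> nat, s = pv (ltype c'.1) &
    forall j : 'I_gq, x j.+1 = pint (d, b, c.2, c'.2) j].
Proof.
move=> c'c x0 xl adj.
have dist t : t <= gq.+1 -> cdist c (x t) = t.
  move=> tq; apply/eqP; rewrite eqn_leq; apply/andP; split.
    elim: t tq => [|t IH] tq; first by rewrite x0 /= eqxx.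
    by apply: leq_trans (cdist_adj c (adj t tq)) _; rewrite ltnS IH // ltnW.
  have H k : k <= gq.+1 -> gq.+1 - k <= cdist c (x (gq.+1 - k)).
    elim: k => [_|k IH kq]; first by rewrite subn0 xl /= (negbTE c'c).
    have := IH (ltnW kq); rewrite subnS.
    have : 0 < gq.+1 - k by rewrite subn_gt0.
    case Ek: (gq.+1 - k) => [//|k'] _ /= lek.
    rewrite -ltnS; apply: leq_trans lek (cdist_adj c (adj k' _)).
    by rewrite -ltnS -Ek leq_subr.
  by have := H (gq.+1 - t) (leq_subr _ _); rewrite subKn.
have q0 := gd_gq gd.
have [d [h [Ed x1]]] : exists (d : 'I_L) h, d = c.1 :> nat /\ x 1 = pint (d, b, c.2, h) (Ordinal q0).
  have := adj 0 isT; have := dist 1 isT; rewrite x0.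
  case: (x 1) => [[[c1 s1]|[p j]]|//].
  - by rewrite /=; case: ifP => // _ [E]; exfalso; move: (gd_gq gd); rewrite E.
  case: p => [[[d b'] g] h] D /orP[]/and4P[/eqP cd /eqP cg /eqP sa /eqP j0].
    exists d, h; split; rewrite ?cd //; rewrite cd in sa.
    rewrite -(gd_att_inj gd (ltype_lt3 _) sa) cg /pint; congr (inl (inr (_, _))).
    by apply: val_inj.
  (* The first step might enter a path ending in [c] from its far end; then [att b] would be the
     vertex [pv]. *)
  have := gd_att_pv gd b (ltype_lt3 d.+1) (ltypeS_neq0 d).
  by rewrite -sa -cd eqxx.
have st : starts c (d, b, c.2, h) by rewrite /= Ed !eqxx.
have xs (j : 'I_gq) : x j.+1 = pint (d, b, c.2, h) j.
  case: j => j jq /=; elim: j jq => [|j IH] jq.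
    by rewrite x1; congr (inl (inr (_, _))); apply: val_inj.
  have jq' := ltnW jq; have := adj j.+1 jq'; have := dist j.+2 (leqW jq); rewrite (IH jq').
  case: (x j.+2) => [[[c1 s1]|[p' j']]|//].
  - rewrite /=; case: ifP => // _ [E].
    by exfalso; move: (jq); rewrite E ltnn.
  move=> D /orP[]/andP[/eqP E /eqP jj]; subst p'.
    by congr (inl (inr (_, _))); apply: val_inj.
  move: D; rewrite /cdist st => D.
  have /eqP : j.+2 = j by exact: etrans (esym D) (esym jj).
  by rewrite gtn_eqF // leqnSn.
have lt : gq.-1 < gq by rewrite prednK.
have := adj gq (leqnn _); rewrite xl -{1}(prednK q0) -[gq.-1]/(val (Ordinal lt)) xs.
case/orP=> /and4P[/eqP E1 /eqP E2 /eqP E3 /eqP E4]; last first.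
  case/eqP: c'c; rewrite [c]surjective_pairing [c']surjective_pairing E2; congr (_, _).
  by apply: val_inj; rewrite /= E1.
exists d => //; split; rewrite ?E1 //.
by rewrite E2.
Qed.

End TargetGraph.
End Gadgets.

Local Open Scope ring_scope.

(** * Depth reduction *)

Section Layers.
Variables (F : fieldType) (n : nat) (I : finType).
Implicit Types (p q : I -> {mpoly F[n]}) (x y : I -> F + 'I_n).

Definition lincomb x p := \sum_h subst_var (x h) * p h.

(** The factors for [false] and [true] will be the left and the right subtree of a tree node, and
    [w b g h] a weight on the path from gate g to gate h. *)
Inductive layered : nat -> (I -> {mpoly F[n]}) -> Prop :=
| Layered0 p : (forall g, p g = 1) -> layered 0 p
| LayeredS L p q (w : bool -> I -> I -> F + 'I_n) : layered L p ->
    (forall g, q g = lincomb (w false g) p * lincomb (w true g) p) ->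
    layered L.+1 q.

Lemma layered_next L p q : layered L p ->
  (forall g, exists x y, q g = lincomb x p * lincomb y p) -> layered L.+1 q.
Proof.
move=> Lp /fin_all_exists[x /fin_all_exists[y Hxy]].
by apply: (LayeredS (w := fun b g => if b then y g else x g) Lp) => g; rewrite Hxy.
Qed.

Variable one : I.

(** The entry [one], which is to hold the polynomial 1, is left out: its coefficient stays free for
    one further constant or variable, which could not be added to a coefficient already in use. *)
Definition nlin p (r : {mpoly F[n]}) :=
  exists2 c : I -> F, c one = 0 & r = \sum_h c h *: p h.

Lemma nlin0 p : nlin p 0.
Proof. by exists (fun=> 0); rewrite ?big1 // => h _; rewrite scale0r. Qed.

Lemma nlinZ p a r : nlin p r -> nlin p (a *: r).
Proof.
case=> c c1 ->; exists (fun h => a * c h); first by rewrite c1 mulr0.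
by rewrite scaler_sumr; apply: eq_bigr => h _; rewrite scalerA.
Qed.

Lemma nlinD p r s : nlin p r -> nlin p s -> nlin p (r + s).
Proof.
case=> c c1 -> [d d1 ->]; exists (fun h => c h + d h); first by rewrite c1 d1 addr0.
by rewrite -big_split; apply: eq_bigr => h _; rewrite scalerDl.
Qed.

Lemma nlin_sum p (J : Type) (r : seq J) (Q : pred J) (G : J -> {mpoly F[n]}) :
  (forall j, Q j -> nlin p (G j)) -> nlin p (\sum_(j <- r | Q j) G j).
Proof.
by move=> H; apply: (big_ind (nlin p)) => //; [exact: nlin0 | exact: nlinD].
Qed.

Lemma nlin_in p h : h != one -> nlin p (p h).
Proof.
move=> h1; exists (fun k => (k == h)%:R); first by rewrite eq_sym (negbTE h1).
rewrite (bigD1 h) //= eqxx scale1r big1 ?addr0 // => k /negbTE ->.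
by rewrite scale0r.
Qed.

Lemma nlin_lincomb p r a : p one = 1 -> nlin p r ->
  exists x, r + subst_var a = lincomb x p.
Proof.
move=> p1 [c c1 ->]; exists (fun h => if h == one then a else inl (c h)).
rewrite /lincomb (bigD1 one) //= c1 scale0r add0r addrC [RHS](bigD1 one) //=.
rewrite eqxx p1 mulr1; congr (_ + _); apply: eq_bigr => h /negbTE -> /=.
by rewrite mul_mpolyC.
Qed.

Lemma nlin_lincomb0 p r : p one = 1 -> nlin p r -> exists x, r = lincomb x p.
Proof.
move=> p1 /(nlin_lincomb (inl 0) p1)[x Hx]; exists x.
by rewrite -Hx /= mpolyC0 addr0.
Qed.

Lemma lincomb_const p a : p one = 1 -> exists x, subst_var a = lincomb x p.
Proof. by move=> p1; have [x E] := nlin_lincomb a p1 (nlin0 p); exists x; rewrite -E add0r. Qed.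

(** Multiplication by the entry 1 repeats a layer, so any larger depth can be met exactly. *)
Lemma layered_pad L k p : p one = 1 -> layered L p -> layered (k + L) p.
Proof.
move=> p1 Lp; elim: k => // k IH; apply: layered_next IH _ => g.
have [x1 E1] := lincomb_const (inl 1) p1.
have [->|g1] := eqVneq g one.
  by exists x1, x1; rewrite -E1 /= mpolyC1 mulr1 p1.
have [y Ey] := nlin_lincomb0 p1 (nlin_in p g1).
by exists y, x1; rewrite -Ey -E1 /= mpolyC1 mulr1.
Qed.

End Layers.

(** * Gate quotients and degree doubling *)

Section DepthReduction.
Variables (F : fieldType) (n : nat) (T : finType) (deg rk : T -> nat).
Variables (X : T -> {mpoly F[n]}) (src : T -> F + 'I_n).
Variables (A : T -> T -> F) (B : T -> T -> T -> F).

(** In a product only the second factor, of larger degree by [HB], is replaced by [Y]. With this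
    convention the same operator governs the gates and their quotients. *)
Definition bilin (Y : T -> {mpoly F[n]}) u :=
  \sum_v A u v *: Y v + \sum_a \sum_b B u a b *: (X a * Y b).

Hypothesis HX : forall u, X u = subst_var (src u) + bilin X u.
Hypothesis HA : forall u v, A u v != 0 -> (rk v < rk u)%N /\ deg v = deg u.
Hypothesis HB : forall u a b, B u a b != 0 ->
  [/\ (rk a < rk u)%N, (rk b < rk u)%N, (deg a + deg b)%N = deg u & (deg a <= deg b)%N].
Hypothesis Hsrc : forall u, deg u = 0%N -> exists c, src u = inl c.

(** The fuel k replaces recursion along [rk]; its value no longer matters once it exceeds [rk u]. *)
Fixpoint quot_rec k u w : {mpoly F[n]} :=
  if k is k'.+1 then (u == w)%:R + bilin (quot_rec k' ^~ w) u else 0.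

(* The gate quotient [u : w]. *)
Definition quot u w := quot_rec (\max_v rk v).+1 u w.

Lemma eq_bilin Y Z u : (forall v, (rk v < rk u)%N -> Y v = Z v) -> bilin Y u = bilin Z u.
Proof.
move=> YZ; congr (_ + _); apply: eq_bigr => a _.
  have [->|/HA[ra _]] := eqVneq (A u a) 0; first by rewrite !scale0r.
  by rewrite YZ.
apply: eq_bigr => b _; have [->|/HB[_ rb _ _]] := eqVneq (B u a b) 0.
  by rewrite !scale0r.
by rewrite YZ.
Qed.

Lemma quot_recE k k' u w : (rk u < k)%N -> (rk u < k')%N -> quot_rec k u w = quot_rec k' u w.
Proof.
elim: k k' u => // k IH [//|k'] u; rewrite !ltnS => uk uk' /=.
congr (_ + _); apply: eq_bilin => v vu.
by apply: IH; [exact: leq_trans vu uk | exact: leq_trans vu uk'].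
Qed.

Lemma quotE u w : quot u w = (u == w)%:R + bilin (quot ^~ w) u.
Proof.
rewrite {1}/quot /=; congr (_ + _); apply: eq_bilin => v vu.
apply: quot_recE; first exact: leq_trans vu (leq_bigmax u).
by rewrite ltnS leq_bigmax.
Qed.

Lemma rk_ind (P : T -> Prop) :
  (forall u, (forall v, (rk v < rk u)%N -> P v) -> P u) -> forall u, P u.
Proof.
move=> H u; have [k] := ubnP (rk u); elim: k u => // k IH u; rewrite ltnS => uk.
by apply: H => v vu; apply: IH; apply: leq_trans vu uk.
Qed.

Lemma quot_lt u w : (deg u < deg w)%N -> quot u w = 0.
Proof.
elim/rk_ind: u => u IH uw; rewrite quotE.
have [E|_] := eqVneq u w; first by rewrite E ltnn in uw.
rewrite add0r /bilin big1 => [|v _]; last first.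
  have [->|/HA[rv dv]] := eqVneq (A u v) 0; first by rewrite scale0r.
  by rewrite IH ?dv // scaler0.
rewrite add0r big1 // => a _; rewrite big1 // => b _.
have [->|/HB[_ rb db _]] := eqVneq (B u a b) 0; first by rewrite scale0r.
by rewrite IH ?mulr0 ?scaler0 //; apply: leq_ltn_trans uw; rewrite -db leq_addl.
Qed.

Definition is_const (p : {mpoly F[n]}) := exists c, p = c%:MP.

Lemma is_const0 : is_const 0.
Proof. by exists 0; rewrite mpolyC0. Qed.
Lemma is_constD p q : is_const p -> is_const q -> is_const (p + q).
Proof. by case=> c -> [d ->]; exists (c + d); rewrite mpolyCD. Qed.
Lemma is_constM p q : is_const p -> is_const q -> is_const (p * q).
Proof. by case=> c -> [d ->]; exists (c * d); rewrite mpolyCM. Qed.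
Lemma is_constZ a p : is_const p -> is_const (a *: p).
Proof. by case=> c ->; exists (a * c); rewrite mpolyCM mul_mpolyC. Qed.
Lemma is_const_sum (J : Type) (r : seq J) (Q : pred J) (G : J -> {mpoly F[n]}) :
  (forall j, Q j -> is_const (G j)) -> is_const (\sum_(j <- r | Q j) G j).
Proof.
by move=> H; apply: (big_ind is_const) => //; [exact: is_const0 | exact: is_constD].
Qed.

Lemma X_const u : deg u = 0%N -> is_const (X u).
Proof.
elim/rk_ind: u => u IH du; rewrite HX; apply: is_constD.
  by have [c ->] := Hsrc du; exists c.
apply: is_constD; apply: is_const_sum => a _.
  have [->|/HA[rv dv]] := eqVneq (A u a) 0; first by rewrite scale0r; exact: is_const0.
  by apply: is_constZ; apply: IH; rewrite ?dv.
apply: is_const_sum => b _.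
have [->|/HB[ra rb /eqP + _]] := eqVneq (B u a b) 0; first by rewrite scale0r; exact: is_const0.
rewrite du addn_eq0 => /andP[/eqP da /eqP db].
by apply: is_constZ; apply: is_constM; apply: IH.
Qed.

(** If no degree is lost between u and w, every factor split off on the way has degree 0 and is a
    constant by [X_const]. *)
Lemma quot_const u w : (deg u <= deg w)%N -> is_const (quot u w).
Proof.
elim/rk_ind: u => u IH du; have [lt|ge] := ltnP (deg u) (deg w).
  by rewrite quot_lt //; exact: is_const0.
rewrite quotE; apply: is_constD.
  by case: eqP => _; [exists 1; rewrite mpolyC1 | exact: is_const0].
apply: is_constD; apply: is_const_sum => a _.
  have [->|/HA[rv dv]] := eqVneq (A u a) 0; first by rewrite scale0r; exact: is_const0.
  by apply: is_constZ; apply: IH; rewrite ?dv.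
apply: is_const_sum => b _.
have [->|/HB[ra rb dab _]] := eqVneq (B u a b) 0; first by rewrite scale0r; exact: is_const0.
have [lt|ge'] := ltnP (deg b) (deg w).
  by rewrite quot_lt // mulr0 scaler0; exact: is_const0.
apply: is_constZ; apply: is_constM; last first.
  by apply: IH => //; apply: leq_trans du; rewrite -dab leq_addl.
apply: X_const; apply/eqP; rewrite -leqn0 -(leq_add2r (deg b)) add0n dab.
exact: leq_trans du ge'.
Qed.

(* Cut every product chain starting at u where its degree drops to at most m. *)
Lemma frontier (Y : T -> {mpoly F[n]}) (s : T -> {mpoly F[n]}) m :
  (forall u, (m < deg u)%N -> Y u = s u + bilin Y u) ->
  forall u, (m < deg u)%N ->
  Y u = \sum_(v | (m < deg v)%N) quot u v *
          (s v + \sum_a \sum_(b | (deg b <= m)%N) B v a b *: (X a * Y b)).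
Proof.
move=> HY u; elim/rk_ind: u => u IH mu.
set Z := fun v => s v + \sum_a \sum_(b | (deg b <= m)%N) B v a b *: (X a * Y b).
rewrite -[RHS]/(\sum_(v | (m < deg v)%N) quot u v * Z v).
(* The right-hand side obeys the recursion of Y in its first argument, by [quotE]. *)
have -> : \sum_(v | (m < deg v)%N) quot u v * Z v =
    Z u + bilin (fun v' => \sum_(v | (m < deg v)%N) quot v' v * Z v) u.
  under eq_bigr => v _ do rewrite quotE mulrDl.
  rewrite big_split; congr (_ + _).
    rewrite (bigD1 u) //= eqxx mul1r big1 ?addr0 // => v /andP[_ /negbTE vu].
    by rewrite eq_sym vu mul0r.
  rewrite /bilin; under eq_bigr => v _ do rewrite mulrDl.
  rewrite big_split; congr (_ + _).
    under eq_bigr => v _ do rewrite mulr_suml.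
    rewrite exchange_big; apply: eq_bigr => v' _.
    by rewrite scaler_sumr; apply: eq_bigr => v _; rewrite scalerAl.
  under eq_bigr => v _ do rewrite mulr_suml.
  rewrite exchange_big; apply: eq_bigr => a _.
  under eq_bigr => v _ do rewrite mulr_suml.
  rewrite exchange_big; apply: eq_bigr => b _.
  rewrite mulr_sumr scaler_sumr; apply: eq_bigr => v _.
  by rewrite -scalerAl mulrA.
rewrite HY // /Z -addrA; congr (_ + _).
rewrite /bilin addrCA; congr (_ + _).
  apply: eq_bigr => v _.
  have [->|/HA[rv dv]] := eqVneq (A u v) 0; first by rewrite !scale0r.
  by rewrite -IH ?dv.
rewrite -big_split; apply: eq_bigr => a _ /=.
rewrite (bigID (fun b => (deg b <= m)%N)) /=; congr (_ + _).
rewrite [RHS](bigID (fun b => (deg b <= m)%N)) /= [X in _ = X + _]big1 ?add0r.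
  apply: eq_bigr => b; rewrite -ltnNge => mb.
  have [->|/HB[_ rb _ _]] := eqVneq (B u a b) 0; first by rewrite !scale0r.
  by rewrite -IH.
(* For b at or below the threshold the chain stops: all quotients of b by a v above it vanish. *)
move=> b bm; rewrite big1 ?mulr0 ?scaler0 // => v mv.
by rewrite quot_lt ?mul0r //; exact: leq_ltn_trans bm mv.
Qed.

(** [None] holds the constant 1, [inl (u, None)] the gate u, [inl (u, Some w)] the quotient [u : w];
    the [inr] entries are scratch space for products within a phase. *)
Definition lstate := option ((T * option T) + (T * T * option T))%type.
Definition sbase u w : lstate := Some (inl (u, w)).
Definition strip a b w : lstate := Some (inr (a, b, w)).

Definition target (w : option T) u := if w is Some w then quot u w else X u.
(** With this offset [upto w d] bounds the degree deg u - deg w of the quotient itself. *)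
Definition woff (w : option T) := if w is Some w then deg w else 0%N.

Implicit Types p q : lstate -> {mpoly F[n]}.

Definition upto (w : option T) d p :=
  forall u, (deg u <= woff w + d)%N -> p (sbase u w) = target w u.

(** Above the threshold deg u exceeds deg w, so the term [u == w] in the recursion of a quotient
    vanishes and its source is 0, whereas a gate keeps its own. *)
Lemma target_frontier w d u : (woff w + d < deg u)%N ->
  target w u = \sum_(v | (woff w + d < deg v)%N) quot u v *
    ((if w is Some _ then 0 else subst_var (src v)) +
     \sum_a \sum_(b | (deg b <= woff w + d)%N) B v a b *: (X a * target w b)).
Proof.
move=> du; apply: (frontier (s := fun v => if w is Some _ then 0 else subst_var (src v))) => //.
case: w {u du} => [w|] u /= du; last exact: HX.
rewrite quotE; case: eqP => // E; first by move: du; rewrite E -ltn_subRL subnn.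
Qed.

(* Three layers evaluate the frontier formula once. *)
Lemma phase L p d : layered L p -> p None = 1 -> upto None d p ->
  (forall w, upto (Some w) d p) ->
  exists q, [/\ layered L.+3 q, q None = 1, upto None d.*2.+1 q,
    (forall w, upto (Some w) d q) &
    (upto None d.*2.+1 p -> forall w, upto (Some w) d.*2.+1 q)].
Proof.
move=> Lp p1 okX okQ.
(* Successive layers form the products of X_a with the target of b, then their combinations
   multiplied by [u : v], then the sum over the frontier. *)
pose p' (g : lstate) := match g with
  | Some (inr (a, b, w)) => p (sbase a None) * p (sbase b w) | _ => p g end.
have Lp' : layered L.+1 p'.
  apply: layered_next Lp _ => -[[[u w]|[[a b] w]]|] /=.
  - have [x1 E1] := lincomb_const (inl 1) p1.
    have [y Ey] := nlin_lincomb0 p1 (nlin_in p (isT : sbase u w != None)).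
    by exists y, x1; rewrite -Ey -E1 /= mpolyC1 mulr1.
  - have [y ->] := nlin_lincomb0 p1 (nlin_in p (isT : sbase a None != None)).
    have [x ->] := nlin_lincomb0 p1 (nlin_in p (isT : sbase b w != None)).
    by exists y, x.
  have [x1 E1] := lincomb_const (inl 1) p1.
  by exists x1, x1; rewrite -E1 /= mpolyC1 mulr1.
have p'1 : p' None = 1 by [].
pose Z w v := \sum_a \sum_(b | (deg b <= woff w + d)%N) B v a b *: p' (strip a b w)
   + subst_var (if w is Some _ then inl 0 else src v).
pose p'' (g : lstate) := match g with
  | Some (inr (u, v, w)) => p' (sbase u (Some v)) * Z w v | _ => p' g end.
have Lp'' : layered L.+2 p''.
  apply: layered_next Lp' _ => -[[[u w]|[[u v] w]]|] /=.
  - have [x1 E1] := lincomb_const (inl 1) p'1.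
    have [y Ey] := nlin_lincomb0 p'1 (nlin_in p' (isT : sbase u w != None)).
    by exists y, x1; rewrite -Ey -E1 /= mpolyC1 mulr1.
  - have [y Ey] := nlin_lincomb0 p'1 (nlin_in p' (isT : sbase u (Some v) != None)).
    suff [x Ex] : exists x, Z w v = lincomb x p' by exists y, x; rewrite -Ey -Ex.
    apply: (@nlin_lincomb _ _ _ None) => //; apply: nlin_sum => a _.
    by apply: nlin_sum => b _; apply: nlinZ; apply: nlin_in.
  have [x1 E1] := lincomb_const (inl 1) p'1.
  by exists x1, x1; rewrite -E1 /= mpolyC1 mulr1.
have p''1 : p'' None = 1 by [].
pose q (g : lstate) := match g with
  | Some (inl (u, w)) => if (deg u <= woff w + d)%N then p'' (sbase u w)
      else \sum_(v | (woff w + d < deg v)%N) p'' (strip u v w)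
  | Some (inr _) => 0 | None => 1 end.
have Lq : layered L.+3 q.
  apply: layered_next Lp'' _ => g.
  have [x1 E1] := lincomb_const (inl 1) p''1.
  suff [x Ex] : exists x, q g = lincomb x p'' by exists x, x1; rewrite -Ex -E1 /= mpolyC1 mulr1.
  case: g => [g|]; last by exists x1; rewrite -E1 /= mpolyC1.
  apply: (@nlin_lincomb0 _ _ _ None) => //.
  case: g => [[u w]|g]; last exact: nlin0.
  rewrite /q; case: ifP => _; first exact: nlin_in.
  by apply: nlin_sum => v _; apply: nlin_in.
(* If [b : w] is not available then b is light and its product with X_a vanishes. *)
have step w : (forall u, (deg u <= woff w + d)%N -> p (sbase u w) = target w u) ->
    (forall u v a b, (deg u <= woff w + d.*2.+1)%N -> (woff w + d < deg v)%N ->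
       (deg v <= deg u)%N -> B v a b != 0 -> (deg b <= woff w + d)%N -> target w b != 0 ->
       p (sbase a None) = X a) -> upto w d.*2.+1 q.
  move=> okw oka u du; rewrite /q /=; case: ifP => [/okw //|/negbT]; rewrite -ltnNge => gu.
  rewrite (target_frontier gu); apply: eq_bigr => v gv.
  have [uv|vu] := ltnP (deg u) (deg v).
    have E : p (sbase u (Some v)) = quot u v.
      by apply: okQ; apply: leq_trans (ltnW uv) (leq_addr _ _).
    by rewrite /= E quot_lt // !mul0r.
  (* From deg u <= woff w + 2d + 1 and deg v >= woff w + d + 1, the quotient [u : v] has degree at
     most d and is available; this is why one phase reaches exactly 2d + 1. *)
  congr (_ * _).
    apply: okQ => /=; apply: leq_trans du _.
    by rewrite -addnn -addSn addnA leq_add2r addnS.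
  rewrite addrC; congr (_ + _); last by case: (w) => //= _; rewrite mpolyC0.
  apply: eq_bigr => a _; apply: eq_bigr => b gb /=.
  have [->|Bn] := eqVneq (B v a b) 0; first by rewrite !scale0r.
  rewrite okw //; have [->|tn] := eqVneq (target w b) 0; first by rewrite !mulr0.
  by rewrite (oka u v a b).
exists q; split => //.
(* For a gate, deg a <= deg b <= d. *)
- apply: step => // u v a b /= du gv vu /HB[_ _ dab leab] gb _.
  by apply: okX; apply: leq_trans gb.
- by move=> w u du; rewrite /q /= du okQ.
(* For a quotient only deg a <= deg u - deg w <= 2d + 1 is known, because a nonzero [b : w] forces
   deg w <= deg b. Gates must therefore be one phase ahead of quotients. *)
move=> okX' w; apply: step => [u|u v a b /= du gv vu /HB[_ _ dab leab] gb tn].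
  exact: okQ.
apply: okX'; rewrite /= add0n.
have wb : (deg w <= deg b)%N by rewrite leqNgt; apply/negP => /quot_lt E; rewrite E eqxx in tn.
rewrite -(leq_add2r (deg b)) dab (leq_trans vu) // (leq_trans du) //.
by rewrite addnC leq_add2l.
Qed.

(** Going from 2^j - 1 to 2(2^j - 1) + 1 = 2^(j+1) - 1 takes two phases of three layers, one for the
    gates and one for the quotients. The single initial layer holds the targets of degree 0, which
    are constants. *)
Lemma layered_targets j : exists q,
  [/\ layered (6 * j).+1 q, q None = 1 & forall w, upto w (2 ^ j).-1 q].
Proof.
elim: j => [|j [q [Lq q1 okq]]].
  pose tgt (g : lstate) := match g with
    | Some (inl (u, w)) => if (deg u <= woff w)%N then target w u else 0
    | Some _ => 0 | None => 1 end.
  have ctgt g : is_const (tgt g).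
    case: g => [[[u w]|_]|] /=; last by exists 1; rewrite mpolyC1.
    - case: ifP => [|_]; last exact: is_const0.
      case: w => [w|] /=; first exact: quot_const.
      by rewrite leqn0 => /eqP; apply: X_const.
    - exact: is_const0.
  exists tgt; split=> //; last by move=> w u; rewrite addn0 /= => ->.
  rewrite muln0; apply: (layered_next (Layered0 (p := fun=> 1) (fun=> erefl))) => g.
  have [c ->] := ctgt g.
  have [x Ex] := @lincomb_const F n _ (None : lstate) (fun=> 1) (inl c) erefl.
  have [y Ey] := @lincomb_const F n _ (None : lstate) (fun=> 1) (inl 1) erefl.
  by exists x, y; rewrite -Ex -Ey /= mpolyC1 mulr1.
have [q' [Lq' q'1 okX' okQ' _]] := phase Lq q1 (okq None) (fun w => okq (Some w)).
have okX0 : upto None (2 ^ j).-1 q'.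
  move=> u du; apply: okX'; apply: leq_trans du _; rewrite leq_add2l.
  by rewrite -addnn leqW // leq_addr.
have [q'' [Lq'' q''1 okX'' _ okQ'']] := phase Lq' q'1 okX0 okQ'.
have E : (2 ^ j.+1).-1 = ((2 ^ j).-1).*2.+1.
  by rewrite expnS mul2n -[in LHS](prednK (expn_gt0 2 j)) doubleS.
exists q''; split=> //; first by rewrite mulnS !addSn.
by move=> [w|]; rewrite E //; apply: okQ''.
Qed.

(** The image of the tree root ranges over all gates of the last layer, so the output is placed at
    [None] and every other entry is 0. *)
Lemma layered_sum_targets L j (R : pred T) : (forall u, deg u < 2 ^ j)%N ->
  ((6 * j).+1 < L)%N ->
  exists2 q, layered L q & \sum_(g : lstate) q g = \sum_(u | R u) X u.
Proof.
move=> Hdeg HL; have [p [Lp p1 okp]] := layered_targets j.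
exists (fun g => if g is None then \sum_(u | R u) X u else 0); last first.
  by rewrite (bigD1 None) //= [X in _ + X]big1 ?addr0 // => -[].
case: L HL => // L; rewrite ltnS => HL.
have Lp' : layered L p by rewrite -(subnK HL); apply: (layered_pad _ p1).
apply: layered_next Lp' _ => g.
have [x1 E1] := lincomb_const (inl 1) p1.
suff [x ->] : exists x, (if g is None then \sum_(u | R u) X u else 0) = lincomb x p.
  by exists x, x1; rewrite -E1 /= mpolyC1 mulr1.
apply: (@nlin_lincomb0 _ _ _ None) => //; case: g => [_|]; first exact: nlin0.
apply: nlin_sum => u _; rewrite -[X u]/(target None u) -okp; first exact: nlin_in.
by rewrite /= add0n -ltnS prednK ?expn_gt0.
Qed.

End DepthReduction.

(** * Homogeneous components of a straight-line program *)

Lemma pihomogM (F : fieldType) (n e : nat) (p q : {mpoly F[n]}) :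
  pihomog mdeg e (p * q) =
  \sum_(a < e.+1) \sum_(b < e.+1 | (a + b == e)%N) pihomog mdeg a p * pihomog mdeg b q.
Proof.
have pZ d c (r : {mpoly F[n]}) : pihomog mdeg d (c *: r) = c *: pihomog mdeg d r.
  exact: linearZ.
have pS d (r : seq 'X_{1..n}) (G : _ -> {mpoly F[n]}) :
    pihomog mdeg d (\sum_(m <- r) G m) = \sum_(m <- r) pihomog mdeg d (G m).
  exact: raddf_sum.
(* Both sides are bilinear, so monomials suffice; there only the pair of their degrees
   contributes. *)
have monoM (m1 m2 : 'X_{1..n}) : pihomog mdeg e ('X_[F, m1] * 'X_[m2]) =
  \sum_(a < e.+1) \sum_(b < e.+1 | (a + b == e)%N)
     pihomog mdeg a 'X_[m1] * pihomog mdeg b 'X_[m2].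
  rewrite -mpolyXD pihomogX /= mdegD; case: eqP => [E|ne].
    have l1 : (mdeg m1 < e.+1)%N by rewrite ltnS -E leq_addr.
    have l2 : (mdeg m2 < e.+1)%N by rewrite ltnS -E leq_addl.
    rewrite (bigD1 (Ordinal l1)) //= (bigD1 (Ordinal l2)) /= ?E //.
    rewrite !pihomogX !eqxx -mpolyXD [X in _ + X + _]big1 ?addr0; last first.
      move=> b /andP[_ nb]; rewrite pihomogX; case: eqP => [Eb|]; rewrite ?mulr0 //.
      by case/eqP: nb; apply: val_inj.
    rewrite [X in _ + X]big1 ?addr0 // => a na; rewrite big1 // => b _.
    rewrite pihomogX; case: eqP => [Ea|]; rewrite ?mul0r //.
    by case/eqP: na; apply: val_inj.
  rewrite big1 // => a _; rewrite big1 // => b /eqP ab; rewrite !pihomogX.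
  case: eqP => [Ea|]; rewrite ?mul0r //; case: eqP => [Eb|]; rewrite ?mulr0 //.
  by case: ne; rewrite Ea Eb.
rewrite {1}[p]mpolyE {1}[q]mpolyE mulr_suml pS.
under eq_bigr => m1 _.
  rewrite mulr_sumr pS.
  under eq_bigr => m2 _ do rewrite -scalerAl -scalerAr !pZ monoM.
  over.
have pE a (r : {mpoly F[n]}) : pihomog mdeg a r =
    \sum_(m <- msupp r) r@_m *: pihomog mdeg a 'X_[m].
  by rewrite {1}[r]mpolyE pS; apply: eq_bigr => m _; rewrite pZ.
under [RHS]eq_bigr => a _ do under eq_bigr => b _ do rewrite (pE a p) (pE b q) mulr_suml.
under [RHS]eq_bigr => a _ do rewrite exchange_big /=.
rewrite [RHS]exchange_big /=; apply: eq_bigr => m1 _.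
under [RHS]eq_bigr => a _ do under eq_bigr => b _ do rewrite mulr_sumr.
under [RHS]eq_bigr => a _ do rewrite exchange_big /=.
rewrite [RHS]exchange_big /=; apply: eq_bigr => m2 _.
rewrite 2![in LHS]scaler_sumr; apply: eq_bigr => a _.
rewrite 2![in LHS]scaler_sumr; apply: eq_bigr => b _.
by rewrite -scalerAl -scalerAr.
Qed.

Section StraightLine.
Variables (F : fieldType) (n : nat).
Implicit Types (prog : seq (gate F n)) (g : gate F n).

Lemma slp_vals_rcons prog g :
  slp_vals (rcons prog g) = rcons (slp_vals prog) (gate_val (slp_vals prog) g).
Proof. by rewrite /slp_vals -cats1 foldl_cat. Qed.

Lemma size_slp_vals prog : size (slp_vals prog) = size prog.
Proof. by elim/last_ind: prog => // p g IH; rewrite slp_vals_rcons !size_rcons IH. Qed.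

Lemma slp_wf_cat k prog1 prog2 :
  slp_wf k (prog1 ++ prog2) = slp_wf k prog1 && slp_wf (size prog1 + k) prog2.
Proof. by elim: prog1 k => //= g p IH k; rewrite IH addSnnS andbA. Qed.

Lemma slp_wf_rcons prog g : slp_wf 0 (rcons prog g) = slp_wf 0 prog && gate_wf (size prog) g.
Proof. by rewrite -cats1 slp_wf_cat addn0 /= andbT. Qed.

Lemma eq_gate_val k g (a b : seq {mpoly F[n]}) : gate_wf k g ->
  (forall j, (j < k)%N -> a`_j = b`_j) -> gate_val a g = gate_val b g.
Proof. by case: g => //= i j /andP[ik jk] E; rewrite !E. Qed.

Lemma slp_valsE prog g0 i : slp_wf 0 prog -> (i < size prog)%N ->
  gate_wf i (nth g0 prog i) /\
  (slp_vals prog)`_i = gate_val (slp_vals prog) (nth g0 prog i).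
Proof.
elim/last_ind: prog => // p g IH; rewrite slp_wf_rcons size_rcons ltnS => /andP[wp wg] ip.
have old j : (j < size p)%N -> (slp_vals (rcons p g))`_j = (slp_vals p)`_j.
  by move=> jp; rewrite slp_vals_rcons nth_rcons size_slp_vals jp.
move: ip; rewrite leq_eqVlt nth_rcons => /predU1P[->|ip].
  rewrite ltnn eqxx; split=> //; rewrite {1}slp_vals_rcons nth_rcons size_slp_vals ltnn eqxx.
  by apply: eq_gate_val wg _ => j jp; rewrite old.
have [wi vi] := IH wp ip; rewrite ip; split=> //; rewrite old // vi.
by apply: eq_gate_val wi _ => j ji; rewrite old // (ltn_trans ji).
Qed.

End StraightLine.

Section Homogenize.
Variables (F : fieldType) (n : nat) (prog : seq (gate F n)) (D : nat).
Hypothesis wf : slp_wf 0 prog.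

Local Notation T := ('I_(size prog) * 'I_D.+1)%type.
Let gt (u : T) := nth (GConst n 0) prog u.1.

Definition hpart (u : T) := pihomog mdeg u.2 (slp_vals prog)`_u.1.

Definition hsrc (u : T) : F + 'I_n :=
  match gt u with
  | GVar i => if u.2 == 1%N :> nat then inr i else inl 0
  | GConst c => if u.2 == 0%N :> nat then inl c else inl 0
  | _ => inl 0
  end.

(** The indicators are added rather than joined, since both inputs may be the same gate. *)
Definition hadd (u v : T) : F :=
  if gt u is GAdd j k then
    ((v.1 == j :> nat) && (v.2 == u.2))%:R + ((v.1 == k :> nat) && (v.2 == u.2))%:R
  else 0.

(* The factor of smaller degree comes first. *)
Definition hmul (u a b : T) : F :=
  if gt u is GMul j k then
    [&& a.1 == j :> nat, b.1 == k :> nat, a.2 + b.2 == u.2 & a.2 <= b.2]%N%:R +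
    [&& a.1 == k :> nat, b.1 == j :> nat, a.2 + b.2 == u.2 & a.2 < b.2]%N%:R
  else 0.

Lemma hadd_neq0 u v : hadd u v != 0 -> (v.1 < u.1)%N /\ v.2 = u.2 :> nat.
Proof.
rewrite /hadd /gt; have [] := slp_valsE (GConst n 0) wf (ltn_ord u.1).
case: (nth _ _ _) => [i|c|j k|j k] /=; rewrite ?eqxx // => /andP[ju ku] _.
case: andP => [[/eqP -> /eqP ->] //|_]; case: andP => [[/eqP -> /eqP ->] //|_].
by rewrite addr0 eqxx.
Qed.

Lemma hmul_neq0 u a b : hmul u a b != 0 ->
  [/\ (a.1 < u.1)%N, (b.1 < u.1)%N, (a.2 + b.2)%N = u.2 & (a.2 <= b.2)%N].
Proof.
rewrite /hmul /gt; have [] := slp_valsE (GConst n 0) wf (ltn_ord u.1).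
case: (nth _ _ _) => [i|c|j k|j k] /=; rewrite ?eqxx // => /andP[ju ku] _.
case: and4P => [[/eqP -> /eqP -> /eqP -> ->] //|_].
case: and4P => [[/eqP -> /eqP -> /eqP -> /ltnW ->] //|_].
by rewrite addr0 eqxx.
Qed.

Lemma hsrc_const (u : T) : u.2 = 0%N :> nat -> exists c, hsrc u = inl c.
Proof.
by move=> u0; rewrite /hsrc u0; case: (gt u) => [i|c|j k|j k] /=; eexists.
Qed.

Lemma hpartE u : hpart u = subst_var (hsrc u) + bilin hpart hadd hmul hpart u.
Proof.
rewrite {1}/hpart /bilin /hsrc /hadd /hmul /gt.
have [wg ->] := slp_valsE (GConst n 0) wf (ltn_ord u.1).
have z1 (G : T -> {mpoly F[n]}) : \sum_v 0 *: G v = 0.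
  by rewrite big1 // => v _; rewrite scale0r.
have z2 (G : T -> T -> {mpoly F[n]}) : \sum_a \sum_b 0 *: G a b = 0.
  by rewrite big1 // => v _; rewrite z1.
have sel j (ju : (j < u.1)%N) : exists2 jo : 'I_(size prog), jo = j :> nat & 
    forall a : T, (a.1 == j :> nat) = (a.1 == jo).
  by exists (Ordinal (ltn_trans ju (ltn_ord _))).
case: (nth _ _ _) wg => [i|c|j k|j k] /= wg; rewrite ?z1 ?z2 ?addr0 ?add0r.
- rewrite pihomogX /= mdeg1 eq_sym; case: eqP => //= _; by rewrite mpolyC0.
- rewrite -[c%:MP]mulr1 mul_mpolyC linearZ /= -mpolyX0 pihomogX /= mdeg0 eq_sym.
  by case: eqP => //= _; rewrite ?mpolyC0 ?scaler0 // mpolyX0 -mul_mpolyC mulr1.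
- rewrite ?mpolyC0 ?add0r raddfD /=.
  case/andP: wg => /sel[jo <- Ej] /sel[ko <- Ek].
  under eq_bigr => v _ do rewrite scalerDl.
  rewrite big_split /=; congr (_ + _).
    rewrite (bigD1 (jo, u.2)) //= !eqxx scale1r big1 ?addr0 // => v nv.
    case: andP => [[/eqP/val_inj v1 /eqP v2]|]; rewrite ?scale0r //.
    by case/eqP: nv; case: v v1 v2 => v1 v2 /= -> ->.
  rewrite (bigD1 (ko, u.2)) //= !eqxx scale1r big1 ?addr0 // => v nv.
  case: andP => [[/eqP/val_inj v1 /eqP v2]|]; rewrite ?scale0r //.
  by case/eqP: nv; case: v v1 v2 => v1 v2 /= -> ->.
rewrite ?mpolyC0 ?add0r pihomogM.
case/andP: wg => /sel[jo Ejo Ej] /sel[ko Eko Ek].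
pose H a b := pihomog mdeg a (slp_vals prog)`_j * pihomog mdeg b (slp_vals prog)`_k.
have uD : (u.2 < D.+1)%N := ltn_ord u.2.
transitivity (\sum_(a < D.+1) \sum_(b < D.+1 | (a + b == u.2)%N) H a b).
  rewrite (big_ord_widen D.+1 (fun a => \sum_(b < u.2.+1 | (a + b == u.2)%N) H a b)) //.
  rewrite big_mkcond /=; apply: eq_bigr => a _; case: ltnP => au.
    rewrite (big_ord_widen_cond D.+1 (fun b => (a + b == u.2)%N) (fun b => H a b)) //.
    apply: eq_bigl => b; case: eqP => //= E; by rewrite ltnS -E leq_addl.
  rewrite big1 // => b /eqP E; move: au; by rewrite -E ltnNge leq_addr.
have selsum (P : 'I_D.+1 -> 'I_D.+1 -> bool) (jo' ko' : 'I_(size prog)) :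
    \sum_(a : T) \sum_(b : T) [&& a.1 == jo', b.1 == ko' & P a.2 b.2]%:R *: (hpart a * hpart b)
    = \sum_a \sum_(b | P a b) hpart (jo', a) * hpart (ko', b).
  transitivity (\sum_(i : 'I_(size prog)) \sum_a \sum_(i' : 'I_(size prog)) \sum_b
      [&& i == jo', i' == ko' & P a b]%:R *: (hpart (i, a) * hpart (i', b))).
    rewrite [RHS]pair_bigA /=; apply: eq_bigr => -[i a] _.
    by rewrite [RHS]pair_bigA; apply: eq_bigr => -[].
  rewrite (bigD1 jo') //= eqxx /= [X in _ + X]big1 ?addr0; last first.
    move=> i /negbTE ij; rewrite big1 // => a _; rewrite big1 // => i' _; rewrite big1 // => b _.
    by rewrite ij scale0r.
  apply: eq_bigr => a _; rewrite (bigD1 ko') //= eqxx /= [X in _ + X]big1 ?addr0; last first.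
    move=> i' /negbTE ij; rewrite big1 // => b _; by rewrite ij scale0r.
  rewrite [RHS]big_mkcond; apply: eq_bigr => b _.
  by case: (P a b); rewrite ?scale1r ?scale0r.
under [RHS]eq_bigr => a _ do (under eq_bigr => b _ do rewrite (Ej a) (Ej b) (Ek a) (Ek b) scalerDl; rewrite big_split /=).
rewrite big_split /= (selsum (fun a b => (a + b == u.2) && (a <= b))%N).
rewrite (selsum (fun a b => (a + b == u.2) && (a < b))%N).
(* The terms with a > b come from the second, swapped indicator; its strict inequality keeps equal
   degrees from being counted twice. *)
rewrite [X in _ = _ + X](exchange_big_dep xpredT) //= -big_split; apply: eq_bigr => a _ /=.
rewrite (bigID (fun b : 'I_D.+1 => (a <= b)%N)) /=; congr (_ + _).
  by apply: eq_bigr => b _; rewrite /H /hpart /= Ejo Eko.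
apply: eq_big => [b|b _]; first by rewrite -ltnNge addnC.
by rewrite /H /hpart /= Ejo Eko mulrC.
Qed.

End Homogenize.

(** Intermediate gates may have degree far above D, but the components of degree at most D depend
    only on one another, so the higher ones are never formed. The output f is the sum of its
    components up to D. *)
Lemma layered_of_slp (F : fieldType) (n : nat) (prog : seq (gate F n)) f D j L :
  computes prog f -> (msize f <= D.+1)%N -> (D < 2 ^ j)%N -> ((6 * j).+1 < L)%N ->
  exists2 q : lstate ('I_(size prog) * 'I_D.+1)%type -> {mpoly F[n]},
    layered L q & \sum_g q g = f.
Proof.
case=> sp wf lastf mf Dj Lj.
pose T := ('I_(size prog) * 'I_D.+1)%type.
have [q Lq sq] := layered_sum_targets (T := T) (deg := fun u => u.2) (rk := fun u => u.1)
  (hpartE wf (D := D)) (hadd_neq0 wf (D := D)) (hmul_neq0 wf (D := D)) (@hsrc_const _ _ prog D)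
  (fun u => u.1 == (size prog).-1 :> nat) (fun u => leq_ltn_trans (leq_ord u.2) Dj) Lj.
exists q => //; rewrite sq.
have l : ((size prog).-1 < size prog)%N by rewrite prednK.
transitivity (\sum_(e < D.+1) hpart (Ordinal l, e)).
  rewrite (reindex_onto (fun e => (Ordinal l, e)) snd) => [|[i e] /= /eqP E].
    by apply: eq_bigl => e; rewrite !eqxx.
  by congr (_, _); apply: val_inj.
rewrite [RHS](pihomog_partitionE (mf := mdeg) mf); apply: eq_bigr => e _.
by rewrite /hpart /= -lastf -nth_last size_slp_vals.
Qed.

(** * Homomorphism sums along the tree *)

Lemma trunc_log2_doubleS k : (0 < k)%N -> trunc_log 2 k.*2.+1 = (trunc_log 2 k).+1.
Proof. by move=> k0; rewrite trunc_log2S /= ?uphalf_double //; lia. Qed.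

Section HeapTree.
Variables (R : comNzRingType) (S : finType).
Implicit Types (g : nat -> S -> R).
Variable p : nat -> S -> S -> R.

(** The weighted sum over labellings of the subtree of height f at heap node k, with label s at its
    root. *)
Fixpoint tree_val g f k s : R :=
  g k s * (if f is f'.+1 then
             (\sum_s' p k.*2 s s' * tree_val g f' k.*2 s') *
             (\sum_s' p k.*2.+1 s s' * tree_val g f' k.*2.+1 s')
           else 1).

Lemma tree_valS g f k s : tree_val g f.+1 k s =
  g k s * ((\sum_s' p k.*2 s s' * tree_val g f k.*2 s') *
           (\sum_s' p k.*2.+1 s s' * tree_val g f k.*2.+1 s')).
Proof. by []. Qed.

Lemma tree_val_neq0 g f k s : tree_val g f k s != 0 -> g k s != 0.
Proof. by apply: contra => /eqP E; case: f => [|f] /=; rewrite E mul0r. Qed.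

Definition parent N (k : 'I_N) : 'I_N := insubd k k./2.

Lemma val_parent N (k : 'I_N) : parent k = k./2 :> nat.
Proof. by rewrite val_insubd; case: ifP => // /negP[]; have := ltn_ord k; lia. Qed.

(** The heap root is 1; the label at index 0 is independent of all others and yields the separate
    factor in [heap_sum_tree]. *)
Definition heap_sum N g : R :=
  \sum_(Psi : {ffun 'I_N -> S})
    \prod_(k < N) (g k (Psi k) * (if (1 < k)%N then p k (Psi (parent k)) (Psi k) else 1)).

(** The last node is a leaf: its label occurs only in its own weight and in the edge to N/2, so
    summing it out changes only the weight of N/2. *)
Lemma heap_sum_elim N g : (1 < N)%N ->
  heap_sum N.+1 g = heap_sum N (fun k s => g k s *
     (if k == N./2 then \sum_s' p N s s' * g N s' else 1)).
Proof.
move=> N1; rewrite /heap_sum.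
have hN : (N./2 < N)%N by lia.
pose ext (q : {ffun 'I_N -> S} * S) : {ffun 'I_N.+1 -> S} :=
  [ffun i => if unlift ord_max i is Some j then q.1 j else q.2].
pose res (f : {ffun 'I_N.+1 -> S}) := ([ffun i => f (lift ord_max i)], f ord_max).
rewrite (reindex_onto ext res) /=; last first.
  move=> f _; apply/ffunP => i; rewrite ffunE /=.
  by case: unliftP => [j ->|->] //; rewrite ffunE.
have extmax q : ext q ord_max = q.2 by rewrite ffunE unlift_none.
have extlift q i : ext q (lift ord_max i) = q.1 i by rewrite ffunE liftK.
rewrite (eq_bigl xpredT) => [|[f s]]; last first.
  apply/eqP; rewrite /res extmax; congr (_, _).
  by apply/ffunP => i; rewrite ffunE extlift.
rewrite -(pair_bigA _ (fun f s => \prod_(k < N.+1) (g k (ext (f, s) k) *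
   (if (1 < k)%N then p k (ext (f, s) (parent k)) (ext (f, s) k) else 1)))) /=.
apply: eq_bigr => f _.
have widenE (i : 'I_N) : widen_ord (leqnSn N) i = lift ord_max i.
  by apply: val_inj; rewrite /= /bump leqNgt ltn_ord.
have lv (i : 'I_N) : lift ord_max i = i :> nat by rewrite -widenE.
under eq_bigr => s _.
  rewrite big_ord_recr /= N1.
  under eq_bigr => k _.
    have -> : parent (widen_ord (leqnSn N) k) = lift ord_max (parent k).
      by apply: val_inj; rewrite -widenE /= !val_parent.
    rewrite widenE !extlift ?lv.
    over.
  have -> : parent (ord_max : 'I_N.+1) = lift ord_max (Ordinal hN).
    by apply: val_inj; rewrite -widenE /= val_parent.
  rewrite extlift extmax /=.
  over.
rewrite -big_distrr /=.
under [RHS]eq_bigr => k _ do rewrite mulrAC.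
rewrite [RHS]big_split /=; congr (_ * _).
rewrite (bigD1 (Ordinal hN)) //= eqxx [X in _ * X]big1 ?mulr1.
  by apply: eq_bigr => s _; rewrite mulrC.
by move=> k /eqP nk; case: eqP => // E; case: nk; apply: val_inj.
Qed.

(** Nodes are summed out from the largest index down. [G n] is the node weight once the nodes n,
    ..., N0 - 1 are absorbed; at n = 2 only the indices 0 and 1 remain. *)
Lemma heap_sum_tree L g : heap_sum (2 ^ L.+1) g =
  (\sum_s g 0%N s) * \sum_s tree_val g L 1 s.
Proof.
set N0 := (2 ^ L.+1)%N.
have N2 : (2 <= N0)%N by rewrite /N0 expnS leq_pmulr ?expn_gt0.
pose D k s := tree_val g (L - trunc_log 2 k) k s.
pose child n c s := if (n <= c < N0)%N then \sum_s' p c s s' * D c s' else 1.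
pose G n k s := g k s * (child n k.*2 s * child n k.*2.+1 s).
have DE k s : (0 < k < N0)%N -> D k s = G 0%N k s.
  case/andP=> k0 kN; rewrite {1}/D /G /child /=.
  have lk : (trunc_log 2 k <= L)%N by rewrite -ltnS -(ltn_exp2l _ _ (isT : 1 < 2)%N) (leq_ltn_trans (trunc_logP _ k0)).
  have [lt|ge] := ltnP (trunc_log 2 k) L.
    have := trunc_log_ltn k (isT : 1 < 2)%N; rewrite -(leq_exp2l _ _ (isT : 1 < 2)%N) in lt.
    move=> kt; have : (k < 2 ^ L)%N by apply: leq_trans kt lt.
    rewrite /N0 expnS => kL.
    have -> : (k.*2 < 2 * 2 ^ L)%N by lia.
    have -> : (k.*2.+1 < 2 * 2 ^ L)%N by lia.
    rewrite leq_exp2l // in lt; rewrite /D trunc_log2_double // trunc_log2_doubleS //.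
    by rewrite -{1}(subnSK lt).
  have E : trunc_log 2 k = L by apply/eqP; rewrite eqn_leq lk.
  rewrite E subnn /= /N0 expnS.
  have : (2 ^ L <= k)%N by rewrite -E trunc_logP.
  move=> kL; have -> : (k.*2 < 2 * 2 ^ L)%N = false by lia.
  have -> : (k.*2.+1 < 2 * 2 ^ L)%N = false by lia.
  by rewrite !mulr1.
have step n : (1 < n < N0)%N -> heap_sum n.+1 (G n.+1) = heap_sum n (G n).
  case/andP=> n1 nN; rewrite heap_sum_elim //; apply: eq_bigr => Psi _.
  apply: eq_bigr => k _; congr (_ * _); rewrite /G -mulrA; congr (_ * _).
  have Dn s' : g n s' * (child n.+1 n.*2 s' * child n.+1 n.*2.+1 s') = D n s'.
    rewrite DE ?nN ?(ltnW n1) // /G /child.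
    by have [-> ->] : (n < n.*2)%N /\ (n < n.*2.+1)%N by lia.
  under eq_bigr => s' _ do rewrite Dn.
  have cS c s : c != n -> child n.+1 c s = child n c s.
    by move=> cn; rewrite /child [(n <= c)%N]leq_eqVlt eq_sym (negbTE cn).
  have cn s : child n n s = \sum_s' p n s s' * D n s' by rewrite /child leqnn nN.
  have cn1 s : child n.+1 n s = 1 by rewrite /child ltnn.
  case: eqP => [E|ne].
    have [En|En] : n = k.*2 \/ n = k.*2.+1 by lia.
      rewrite -En cn cn1 mul1r mulrC; congr (_ * _); apply: cS; lia.
    rewrite -En cn cn1 mulr1; congr (_ * _); apply: cS; lia.
  rewrite mulr1; congr (_ * _); apply: cS; lia.
have down j : (j + 2 <= N0)%N -> heap_sum (j + 2) (G (j + 2)%N) = heap_sum 2 (G 2%N).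
  elim: j => // j IH jN; rewrite addSn step ?IH //; lia.
transitivity (heap_sum N0 (G N0)).
  apply: eq_bigr => Psi _; apply: eq_bigr => k _; congr (_ * _).
  have cN c s : child N0 c s = 1 by rewrite /child; case: ifP => //; lia.
  by rewrite /G !cN !mulr1.
rewrite -[in LHS](subnK N2) down ?subnK // /heap_sum.
transitivity (\sum_(Psi : {ffun 'I_2 -> S}) \prod_(k < 2) G 2%N k (Psi k)).
  by apply: eq_bigr => Psi _; rewrite !big_ord_recl !big_ord0 /= !mulr1.
rewrite -(bigA_distr_bigA (fun (k : 'I_2) s => G 2%N k s)) !big_ord_recl big_ord0 /=; rewrite mulr1.
congr (_ * _); apply: eq_bigr => s _; first by rewrite /G /child /= !mulr1.
have <- : D 1%N s = tree_val g L 1 s by rewrite /D trunc_log1 subn0.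
by rewrite DE ?N2 // /G /child.
Qed.

End HeapTree.

(** Allows the orientation by [enum_rank] in the polynomial to be replaced by one along the tree. *)
Lemma prod_orient (R : comNzRingType) (V : finType) (e o1 o2 : rel V) (f : V -> V -> R) :
  ssrbool.symmetric e -> (forall x y, f x y = f y x) ->
  (forall x y, e x y -> o1 x y = ~~ o1 y x) -> (forall x y, e x y -> o2 x y = ~~ o2 y x) ->
  \prod_(q : V * V | e q.1 q.2 && o1 q.1 q.2) f q.1 q.2 =
  \prod_(q : V * V | e q.1 q.2 && o2 q.1 q.2) f q.1 q.2.
Proof.
move=> se sf O1 O2.
pose h (o : rel V) (q : V * V) := if o q.1 q.2 then q else (q.2, q.1).
have irr x : e x x = false.
  by apply/negP => exx; have := O1 x x exx; case: (o1 x x).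
have neq x y : e x y -> ((y, x) == (x, y)) = false.
  by move=> exy; apply/eqP => -[E _]; move: exy; rewrite E irr.
rewrite (reindex_onto (h o1) (h o2)) => [|[x y] /= /andP[exy oxy]]; last first.
  rewrite {2}/h /=; case: (o2 x y); rewrite /h /= ?oxy //.
  by have := O1 _ _ exy; rewrite oxy; case: (o1 y x).
apply: eq_big => [[x y]|[x y] _]; last by rewrite /h /=; case: ifP => //= _; exact: sf.
rewrite /= /h /=; have [exy|nexy] := boolP (e x y); last first.
  by case: ifP => _ /=; rewrite ?(negbTE nexy) // se (negbTE nexy).
have eyx : e y x by rewrite se.
have := O2 _ _ exy; have := O1 _ _ exy.
case E1: (o1 x y) => /esym E1' E2 /=; rewrite ?E1 ?exy ?eyx /=.
  by rewrite E2; case: (o2 y x); rewrite /= ?neq ?eqxx.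
rewrite -[o1 y x]negbK E1' /= E2; case: (o2 y x) => //=; first by rewrite neq.
by rewrite eqxx.
Qed.

Lemma enum_rank_lt (T : finType) (x y : T) : x != y ->
  (enum_rank x < enum_rank y)%N = ~~ (enum_rank y < enum_rank x)%N.
Proof.
move=> xy; rewrite -leqNgt [RHS]leq_eqVlt (inj_eq (@ord_inj _)).
by rewrite (inj_eq enum_rank_inj) (negbTE xy).
Qed.

(** * Splitting G_m into gadgets and connecting paths *)

Section GraphSum.
Variables (V0 V1 V2 : finType) (e0 : rel V0) (e1 : rel V1) (e2 : rel V2).
Variables (vl0 vr0 : V0) (vl1 vr1 vp1 : V1) (vl2 vr2 vp2 : V2) (cmax m : nat).

Local Notation S := (gS V0 V1 V2).
Local Notation eS := (geS e0 e1 e2).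
Local Notation tag := (@gtag V0 V1 V2).
Local Notation gq := (gq cmax).
Local Notation raw := (graw V0 V1 V2 cmax m).
Local Notation valid := (@gvalid V0 V1 V2 cmax m).
Local Notation gpath := (@gpath V0 V1 V2 vl0 vr0 vl1 vr1 vp1 vl2 vr2 vp2 cmax m).
Local Notation grawE := (@grawE V0 V1 V2 e0 e1 e2 vl0 vr0 vl1 vr1 vp1 vl2 vr2 vp2 cmax m).
Local Notation GE := (@GE V0 V1 V2 e0 e1 e2 vl0 vr0 vl1 vr1 vp1 vl2 vr2 vp2 cmax m).
Local Notation GV := (@GV V0 V1 V2 cmax m).
Local Notation K := 'I_(2 * m).

Definition gatt (b : bool) (i : nat) : S :=
  (if b then @grv V0 V1 V2 vr0 vr1 vr2 else @glv V0 V1 V2 vl0 vl1 vl2) i.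
Local Notation gpv := (@gpv V0 V1 V2 vl0 vp1 vp2).

Hypotheses (s0 : simple_graph e0) (s1 : simple_graph e1) (s2 : simple_graph e2).
Hypothesis gq0 : (0 < gq)%N.

Lemma geS_sym : ssrbool.symmetric eS.
Proof. by move=> [x|[x|x]] [y|[y|y]] //=; [exact: s0.1 | exact: s1.1 | exact: s2.1]. Qed.

Lemma geS_irr : irreflexive eS.
Proof. by move=> [x|[x|x]] /=; [exact: s0.2 | exact: s1.2 | exact: s2.2]. Qed.

Lemma geS_tag x y : eS x y -> tag x = tag y.
Proof. by case: x y => [x|[x|x]] [y|[y|y]]. Qed.

Lemma gtypeE k : gtype k = ltype (trunc_log 2 k).
Proof. by []. Qed.

Lemma tag_gatt b i : (i < 3)%N -> tag (gatt b i) = i.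
Proof. by case: i b => [|[|[|i]]] []. Qed.

Lemma tag_gpv i : (i < 3)%N -> tag (gpv i) = i.
Proof. by case: i => [|[|[|i]]]. Qed.

(** The path edges of [grawE] without quantifiers, oriented from parent to child; an odd k is a
    right child. *)
Definition on_path (x y : raw) : bool :=
  match x, y with
  | inl (k', s), inr (k, j) =>
      [&& 1 < k, k' == parent k, s == gatt (odd k) (gtype k./2) & j == 0 :> nat]%N
  | inr (k, j), inr (k', j') => [&& 1 < k, k == k' & j' == j.+1 :> nat]%N
  | inr (k, j), inl (k', s) => [&& 1 < k, k' == k, s == gpv (gtype k) & j.+1 == gq]%N
  | _, _ => false
  end.

Definition in_gadget (x y : raw) : bool :=
  match x, y with
  | inl (k, s), inl (k', s') => (k == k') && eS s s'
  | _, _ => false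
  end.

Lemma gpath0 k : gpath k 0 = inl (parent k, gatt (odd k) (gtype k./2)).
Proof. by rewrite /gpath /gatt /=; case: odd. Qed.

Lemma gpath_mid (k : K) (j : 'I_gq) : gpath k j.+1 = inr (k, j).
Proof. by rewrite /gpath /= ltn_ord valK. Qed.

Lemma gpath_end k : gpath k gq.+1 = inl (k, gpv (gtype k)).
Proof. by rewrite /gpath /= ltnn. Qed.

Lemma on_pathP x y : reflect (exists (k : K) (t : 'I_gq.+1),
  [/\ (1 < k)%N, x = gpath k t & y = gpath k t.+1]) (on_path x y).
Proof.
apply: (iffP idP) => [|[k [t [k1 -> ->]]]].
  case: x y => [[k s]|[k j]] [[k' s']|[k' j']] //.
  - case/and4P=> k1 /eqP -> /eqP -> /eqP j0; exists k', ord0.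
    by rewrite gpath0 -gpath_mid j0.
  - case/and4P=> k1 /eqP -> /eqP -> /eqP jq; exists k, ord_max.
    by rewrite gpath_end -gpath_mid jq.
  case/and3P=> k1 /eqP <- /eqP jj.
  exists k, (Ordinal (leqW (ltn_ord j') : j'  < gq.+1)%N).
  by split; rewrite // -gpath_mid // -jj.
case: t => -[|t] tq.
  rewrite -[X in gpath k X]/0%N -[X in on_path _ (gpath k X)]/1%N.
  have -> : gpath k 1 = inr (k, Ordinal gq0) by rewrite -gpath_mid.
  by rewrite gpath0 /= k1 !eqxx.
have tq' : (t < gq)%N by [].
rewrite -[X in gpath k X]/t.+1 -[X in on_path _ (gpath k X)]/t.+2.
have -> : gpath k t.+1 = inr (k, Ordinal tq') by rewrite -gpath_mid.
have [lt|ge] := ltnP t.+1 gq.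
  have -> : gpath k t.+2 = inr (k, Ordinal lt) by rewrite -gpath_mid.
  by rewrite /= k1 !eqxx.
have E : t.+1 = gq by apply/eqP; rewrite eqn_leq tq' ge.
have -> : gpath k t.+2 = inl (k, gpv (gtype k)) by rewrite E gpath_end.
by rewrite /= k1 E !eqxx.
Qed.

Lemma grawE_arcs x y : grawE x y = [|| in_gadget x y, on_path x y | on_path y x].
Proof.
congr (_ || _); apply/existsP/orP => [[k /existsP[t /andP[k1 /orP[]/andP[/eqP -> /eqP ->]]]]|].
- by left; apply/on_pathP; exists k, t.
- by right; apply/on_pathP; exists k, t.
by case=> /on_pathP[k [t [k1 -> ->]]]; exists k; apply/existsP; exists t;
  rewrite k1 !eqxx ?orbT.
Qed.

Lemma on_path_anti x y : on_path x y -> on_path y x = false.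
Proof.
move=> xy; apply/negP => yx; move: xy yx.
case: x y => [[k s]|[k j]] [[k' s']|[k' j']] //.
- case/and4P=> k1 /eqP -> _ _ /and4P[_ /eqP E _ _].
  by have := congr1 val E; rewrite /= val_parent; lia.
- case/and4P=> k1 /eqP -> _ _ /and4P[_ /eqP E _ _].
  by have := congr1 val E; rewrite /= val_parent; lia.
by case/and3P=> _ _ /eqP jj /and3P[_ _ /eqP]; rewrite jj; lia.
Qed.

Definition arc (x y : raw) : bool :=
  match x, y with
  | inl (k, s), inl (k', s') => (enum_rank s < enum_rank s')%N
  | _, _ => on_path x y
  end.

Variables (R : comNzRingType) (W : finType) (w0 : W) (w : W -> W -> R).
Hypothesis w_sym : forall a b, w a b = w b a.

(** A label of node k is a map on all of [S], while G_m contains only one component there. Pinning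
    the other values to [w0] makes every map of G_m count once. *)
Definition gadget_weight k (s : {ffun S -> W}) : R :=
  if [forall x, ((0 < k)%N && (tag x == gtype k)) || (s x == w0)]
  then \prod_(x | (0 < k)%N && (tag x == gtype k))
         \prod_(y | eS x y && (enum_rank x < enum_rank y)%N) w (s x) (s y)
  else 0.

Definition path_weight (a b : W) (pi : {ffun 'I_gq -> W}) : R :=
  \prod_(j < gq) ((if j == 0 :> nat then w a (pi j) else 1) *
           (if j.+1 == gq then w (pi j) b else 1) *
           \prod_(j' < gq | j' == j.+1 :> nat) w (pi j) (pi j')).

Definition link_weight k (s s' : {ffun S -> W}) : R :=
  \sum_(pi : {ffun 'I_gq -> W})
    path_weight (s (gatt (odd k) (gtype k./2))) (s' (gpv (gtype k))) pi.

Definition graph_sum : R :=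
  \sum_(phi : {ffun GV -> W})
    \prod_(q : GV * GV | GE q.1 q.2 && (enum_rank q.1 < enum_rank q.2)%N)
       w (phi q.1) (phi q.2).

Lemma GE_sym : ssrbool.symmetric GE.
Proof.
move=> x y; rewrite /GE !grawE_arcs orbA orbAC -orbA; congr (_ || _).
case: (val x) (val y) => [[k s]|[k j]] [[k' s']|[k' j']] //=.
by rewrite geS_sym eq_sym.
Qed.

Lemma GE_irr : irreflexive GE.
Proof.
move=> x; rewrite /GE grawE_arcs; have := @on_path_anti (val x) (val x).
case: (on_path _ _) => [/(_ isT)//|_]; case: (val x) => [[k s]|[k j]] //=.
by rewrite geS_irr andbF.
Qed.

Lemma graph_sum_arcs : graph_sum =
  \sum_(phi : {ffun GV -> W}) \prod_(x : GV) \prod_(y : GV | GE x y && arc (val x) (val y))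
    w (phi x) (phi y).
Proof.
apply: eq_bigr => phi _; rewrite pair_big_dep /=.
apply: (prod_orient (e := GE) (f := fun x y => w (phi x) (phi y))
  (o1 := fun x y => (enum_rank x < enum_rank y)%N) (o2 := fun x y => arc (val x) (val y))).
- exact: GE_sym.
- by move=> x y.
- by move=> x y xy; apply: enum_rank_lt; apply: contraTneq xy => ->; rewrite GE_irr.
have H (p q : bool) : (p -> q = false) -> p || q -> p = ~~ q.
  by case: p q => [] [] // /(_ isT).
move=> x y; rewrite /GE grawE_arcs.
have := @on_path_anti (val x) (val y).
case: (val x) (val y) => [[k s]|[k j]] [[k' s']|[k' j']] //=.
- rewrite !orbF => _ /andP[_ ss']; apply: enum_rank_lt.
  by apply/eqP => E; move: ss'; rewrite E geS_irr.
- exact: H.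
- exact: H.
exact: H.
Qed.

Implicit Types (Psi : {ffun K -> {ffun S -> W}}) (Pi : {ffun K -> {ffun 'I_gq -> W}}).

Definition assign Psi Pi (x : raw) : W :=
  match x with inl (k, s) => Psi k s | inr (k, j) => Pi k j end.

Lemma grawE_arc x y : grawE x y && arc x y =
  if (x, y) is (inl (k, s), inl (k', s')) then
    [&& k == k', eS s s' & enum_rank s < enum_rank s']%N
  else on_path x y.
Proof.
have H (p q : bool) : (p || q) && p = p by case: p q => [] [].
rewrite grawE_arcs; case: x y => [[k s]|[k j]] [[k' s']|[k' j']] //=.
by rewrite !orbF andbA.
Qed.

Lemma prod_valid (P : pred raw) (f : raw -> R) :
  \prod_(x : GV | P (val x)) f (val x) = \prod_(x | valid x && P x) f x.
Proof. exact/esym/(big_sub_cond valid P f). Qed.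

Lemma prod_raw_arcs (ga : rel raw) (f : raw -> raw -> R) :
  (forall x y, ga x y = if (x, y) is (inl (k, s), inl (k', s')) then
    [&& k == k', eS s s' & enum_rank s < enum_rank s']%N else on_path x y) ->
  \prod_(x | valid x) \prod_(y | valid y && ga x y) f x y =
  (\prod_(k < 2 * m) \prod_(s | (0 < k)%N && (tag s == gtype k))
     \prod_(s' | eS s s' && (enum_rank s < enum_rank s')%N) f (inl (k, s)) (inl (k, s'))) *
  \prod_(k < 2 * m | (1 < k)%N) \prod_(j < gq)
    ((if j == 0 :> nat then f (inl (parent k, gatt (odd k) (gtype k./2))) (inr (k, j)) else 1) *
     (if j.+1 == gq then f (inr (k, j)) (inl (k, gpv (gtype k))) else 1) *
     \prod_(j' < gq | j' == j.+1 :> nat) f (inr (k, j)) (inr (k, j'))).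
Proof.
move=> gaE.
rewrite big_sumType /=.
under eq_bigr => x _ do rewrite big_sumType /=.
under [X in _ * X]eq_bigr => x _ do rewrite big_sumType /=.
rewrite !big_split /= -mulrA; congr (_ * _).
  rewrite [RHS]pair_big_dep /=; apply: eq_big => [[k s]|[k s] /= /andP[k0 tk]] //.
  rewrite (reindex_onto (fun s' => (k, s')) snd) => [|[k' s'] /=]; last first.
    by rewrite gaE => /and3P[_ /eqP <-].
  apply: eq_bigl => s'; rewrite gaE /= !eqxx /= andbT k0.
  by case ss': (eS s s'); rewrite ?andbF // -(geS_tag ss') tk.
rewrite [RHS]pair_big_dep /= [X in X * _](exchange_big_dep (fun y => valid (inr y))) /=; last first.
  by move=> x y _ /andP[].
rewrite -!big_split /=; apply: eq_big => [[k j]|[k j] /= k1]; first by rewrite andbT.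
 rewrite -mulrA; congr (_ * _).
  case: ifP => j0; last first.
    by rewrite big_pred0 // => -[k' s]; rewrite gaE /= j0 !andbF.
  rewrite (big_pred1 (parent k, gatt (odd k) (gtype k./2))) // => -[k' s].
  rewrite gaE /= k1 j0 !andbT /= -pair_eqE /=.
  have [->|_] := eqVneq k' (parent k); rewrite ?andbF //=.
  have [->|_] := eqVneq s (gatt (odd k) (gtype k./2)); rewrite ?andbF //=.
  rewrite tag_gatt ?ltype_lt3 // val_parent eqxx andbT; apply/idP; lia.
congr (_ * _).
  case: ifP => jq; last first.
    by rewrite big_pred0 // => -[k' s]; rewrite gaE /= jq !andbF.
  rewrite (big_pred1 (k, gpv (gtype k))) // => -[k' s].
  rewrite gaE /= k1 jq !andbT /= -pair_eqE /=.
  have [->|_] := eqVneq k' k; rewrite ?andbF //=.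
  have [->|_] := eqVneq s (gpv (gtype k)); rewrite ?andbF //=.
  by rewrite tag_gpv ?ltype_lt3 // eqxx ?andbT (ltnW k1) ?eqxx.
rewrite (reindex_onto (fun j' => (k, j')) snd) => [|[k' j'] /=]; last first.
  by rewrite gaE => /and4P[_ _ /eqP <-].
by apply: eq_bigl => j'; rewrite gaE /= !eqxx k1 andbT.
Qed.

Lemma prod_valid_arcs (f : raw -> raw -> R) :
  \prod_(x : GV) \prod_(y : GV | GE x y && arc (val x) (val y)) f (val x) (val y) =
  (\prod_(k < 2 * m) \prod_(s | (0 < k)%N && (tag s == gtype k))
     \prod_(s' | eS s s' && (enum_rank s < enum_rank s')%N) f (inl (k, s)) (inl (k, s'))) *
  \prod_(k < 2 * m | (1 < k)%N) \prod_(j < gq)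
    ((if j == 0 :> nat then f (inl (parent k, gatt (odd k) (gtype k./2))) (inr (k, j)) else 1) *
     (if j.+1 == gq then f (inr (k, j)) (inl (k, gpv (gtype k))) else 1) *
     \prod_(j' < gq | j' == j.+1 :> nat) f (inr (k, j)) (inr (k, j'))).
Proof.
rewrite -(prod_raw_arcs _ grawE_arc).
transitivity (\prod_(x : GV) (fun x => \prod_(y | valid y && (grawE x y && arc x y)) f x y) (val x)).
  by apply: eq_bigr => x _; apply: (prod_valid (fun y => grawE (val x) y && arc (val x) y)).
rewrite (prod_valid xpredT (fun x => \prod_(y | valid y && (grawE x y && arc x y)) f x y)).
by apply: eq_bigl => x; rewrite andbT.
Qed.

(** A map on the valid vertices is a pair of families on all raw vertices with value [w0] at the
    invalid ones. Once the gadget maps are fixed, the path interiors are independent, so their sum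
    is a product of link weights. *)
Lemma graph_sum_heap : graph_sum = heap_sum link_weight (2 * m) gadget_weight.
Proof.
pose A Psi Pi : {ffun GV -> W} := [ffun x => assign Psi Pi (val x)].
pose at_ (phi : {ffun GV -> W}) x := oapp phi w0 (insub x).
pose B phi := ([ffun k => [ffun s => at_ phi (inl (k, s))]] : {ffun K -> {ffun S -> W}},
               [ffun k => [ffun j => at_ phi (inr (k, j))]] : {ffun K -> {ffun 'I_gq -> W}}).
rewrite graph_sum_arcs (reindex_onto (fun q => A q.1 q.2) B) => [|phi _]; last first.
  apply/ffunP => x; rewrite ffunE -[phi x]/(oapp phi w0 (Some x)) -(valK x) /=.
  by case: (val x) => [[k s]|[k j]] /=; rewrite !ffunE.
pose okS (k : K) (s : {ffun S -> W}) :=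
  [forall x, ((0 < k)%N && (tag x == gtype k)) || (s x == w0)].
pose okP (k : K) (p : {ffun 'I_gq -> W}) := [forall j, (1 < k)%N || (p j == w0)].
pose G (k : K) (s : {ffun S -> W}) :=
  \prod_(x | (0 < k)%N && (tag x == gtype k))
    \prod_(y | eS x y && (enum_rank x < enum_rank y)%N) w (s x) (s y).
pose P (k : K) (s s' : {ffun S -> W}) (p : {ffun 'I_gq -> W}) := if (1 < k)%N then
  path_weight (s (gatt (odd k) (gtype k./2))) (s' (gpv (gtype k))) p else 1.
transitivity (\sum_(q : {ffun K -> {ffun S -> W}} * {ffun K -> {ffun 'I_gq -> W}} |
    (q.1 \in family okS) && (q.2 \in family okP))
  (\prod_(k < 2 * m) G k (q.1 k)) * \prod_(k < 2 * m) P k (q.1 (parent k)) (q.1 k) (q.2 k)).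
  apply: eq_big => [[Psi Pi]|[Psi Pi] _] /=.
    rewrite -pair_eqE /=; congr (_ && _).
      apply/eqP/familyP => [E k|ok].
        apply/forallP => x; rewrite -E !ffunE /at_.
        by case: insubP => [u|] /=; [move=> -> | rewrite eqxx orbT].
      apply/ffunP => k; apply/ffunP => x; rewrite !ffunE /at_.
      case: insubP => [u _ vu|] /=; first by rewrite ffunE vu.
      by have /forallP/(_ x)/orP[->|/eqP] := ok k.
    apply/eqP/familyP => [E k|ok].
      apply/forallP => x; rewrite -E !ffunE /at_.
      by case: insubP => [u|] /=; [move=> -> | rewrite eqxx orbT].
    apply/ffunP => k; apply/ffunP => x; rewrite !ffunE /at_.
    case: insubP => [u _ vu|] /=; first by rewrite ffunE vu.
    by have /forallP/(_ x)/orP[->|/eqP] := ok k.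
  under eq_bigr => x _ do under eq_bigr => y _ do rewrite !ffunE.
  rewrite (prod_valid_arcs (fun x y => w (assign Psi Pi x) (assign Psi Pi y))).
  congr (_ * _); rewrite big_mkcond; apply: eq_bigr => k _.
  by rewrite /P; case: ifP => // _.
rewrite -(pair_big (mem (family okS)) (mem (family okP)) (fun Psi Pi =>
  (\prod_(k < 2 * m) G k (Psi k)) * \prod_(k < 2 * m) P k (Psi (parent k)) (Psi k) (Pi k))) /=.
rewrite big_mkcond /=; apply: eq_bigr => Psi _.
rewrite big_split /=; case: ifP => [/familyP ok|/negbT/familyP nok]; last first.
  have [/forallP ok|/forallPn[k nk]] := boolP [forall k, okS k (Psi k)]; first by case: nok.
  rewrite [X in _ = X * _](bigD1 k) //= {1}/gadget_weight.
  by rewrite -[ [forall x, _] ]/(okS k (Psi k)) (negbTE nk) !mul0r.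
rewrite -big_distrr /=; congr (_ * _).
  apply: eq_bigr => k _; rewrite /gadget_weight.
  by rewrite -[ [forall x, _] ]/(okS k (Psi k)) -[okS _ _]/(Psi k \in okS k) ok.
rewrite -(bigA_distr_big_dep okP (fun k p => P k (Psi (parent k)) (Psi k) p)).
apply: eq_bigr => k _; rewrite /P /okP; case: ltnP => k1 /=.
  by apply: eq_bigl => p; apply/forallP.
rewrite (big_pred1 [ffun=> w0]) // => p; apply/forallP/eqP => [E|-> j]; last by rewrite ffunE.
by apply/ffunP => j; rewrite ffunE; apply/eqP.
Qed.

End GraphSum.

(** Index 0 admits only the constant map [w0], of weight 1, so its factor disappears. *)
Lemma tree_of_graph_sum (V0 V1 V2 : finType) (e0 : rel V0) (e1 : rel V1) (e2 : rel V2)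
  (vl0 vr0 : V0) (vl1 vr1 vp1 : V1) (vl2 vr2 vp2 : V2) (cmax L : nat)
  (R : comNzRingType) (W : finType) (w0 : W) (w : W -> W -> R) :
  simple_graph e0 -> simple_graph e1 -> simple_graph e2 -> (0 < gq cmax)%N ->
  (forall a b, w a b = w b a) ->
  graph_sum e0 e1 e2 vl0 vr0 vl1 vr1 vp1 vl2 vr2 vp2 cmax (2 ^ L) w =
  \sum_s tree_val (link_weight vl0 vr0 vl1 vr1 vp1 vl2 vr2 vp2 cmax w)
           (gadget_weight e0 e1 e2 w0 w) L 1 s.
Proof.
move=> s0 s1 s2 gq0 ws; rewrite (graph_sum_heap _ _ _ _ _ _ _ _ _ s0 s1 s2 gq0 w0 ws).
rewrite -expnS heap_sum_tree (bigD1 [ffun=> w0]) //= [X in (_ + X) * _]big1 => [|s ns].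
  rewrite addr0 /gadget_weight; case: ifP => [_|/forallP[] x]; last by rewrite ffunE eqxx orbT.
  by rewrite big_pred0 ?mul1r // => x.
rewrite /gadget_weight; case: ifP => // /forallP s_w0; case/eqP: ns.
by apply/ffunP => x; rewrite ffunE; apply/eqP; have := s_w0 x.
Qed.

(** A map into a complete graph that is not a homomorphism identifies the ends of some edge and so
    picks up a factor [w a a = 0]. *)
Lemma hom_sum_complete (R : comNzRingType) (V : finType) (e : rel V) (N : nat)
    (w : 'I_N -> 'I_N -> R) :
  ssrbool.symmetric e -> irreflexive e -> (forall a, w a a = 0) ->
  \sum_(phi : {ffun V -> 'I_N} | homb e (@KE N) phi)
    \prod_(q : V * V | e q.1 q.2 && (enum_rank q.1 < enum_rank q.2)%N) w (phi q.1) (phi q.2) =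
  \sum_(phi : {ffun V -> 'I_N})
    \prod_(q : V * V | e q.1 q.2 && (enum_rank q.1 < enum_rank q.2)%N) w (phi q.1) (phi q.2).
Proof.
move=> e_sym e_irr w0; rewrite big_mkcond; apply: eq_bigr => phi _; case: ifP => // /negbT.
have zero x y : e x y -> phi x = phi y -> (enum_rank x < enum_rank y)%N ->
    \prod_(q : V * V | e q.1 q.2 && (enum_rank q.1 < enum_rank q.2)%N) w (phi q.1) (phi q.2) = 0.
  by move=> xy E r; rewrite (bigD1 (x, y)) /= ?xy // E w0 mul0r.
case/forallPn=> x /forallPn[y]; rewrite negb_imply /KE negbK => /andP[xy /eqP E].
have [/(zero _ _ xy E) //|] := boolP (enum_rank x < enum_rank y)%N.
rewrite enum_rank_lt ?negbK; last by apply: contraTneq xy => ->; rewrite e_irr.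
by move/(zero y x) ->; rewrite // e_sym.
Qed.

Lemma hom_poly_comp (F : fieldType) (V : finType) (e : rel V) (N n : nat)
    (w : 'I_N -> 'I_N -> F + 'I_n) :
  ssrbool.symmetric e -> irreflexive e -> (forall a b, w a b = w b a) ->
  (forall a, subst_var (w a a) = 0) ->
  comp_mpoly [tuple subst_var (w (enum_val j).1 (enum_val j).2) | j < #|{: 'I_N * 'I_N}|]
    (hom_poly F e (@KE N)) =
  \sum_(phi : {ffun V -> 'I_N})
    \prod_(q : V * V | e q.1 q.2 && (enum_rank q.1 < enum_rank q.2)%N)
      subst_var (w (phi q.1) (phi q.2)).
Proof.
move=> e_sym e_irr w_sym w0.
rewrite -(hom_sum_complete (w := fun a b => subst_var (w a b))) // /hom_poly rmorph_sum.
apply: eq_bigr => phi _; rewrite rmorph_prod; apply: eq_bigr => q _ /=.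
rewrite comp_mpolyXU -tnth_nth tnth_mktuple /uvar.
by case: ifP => _; rewrite enum_rankK //= w_sym.
Qed.

Lemma hom_sum_bij (R : comNzRingType) (V W W' : finType) (P : pred (V * V)) (h : W -> W')
    (w : W' -> W' -> R) : bijective h ->
  \sum_(phi : {ffun V -> W'}) \prod_(q | P q) w (phi q.1) (phi q.2) =
  \sum_(phi : {ffun V -> W}) \prod_(q | P q) w (h (phi q.1)) (h (phi q.2)).
Proof.
case=> h' hK h'K.
rewrite (reindex (fun phi : {ffun V -> W} => [ffun x => h (phi x)])) /=.
  by apply: eq_bigr => phi _; apply: eq_bigr => q _; rewrite !ffunE.
by exists (fun phi : {ffun V -> W'} => [ffun x => h' (phi x)]) => phi _; apply/ffunP => x;
  rewrite !ffunE.
Qed.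

(** * Evaluating the homomorphism polynomial by circuits *)

Section CircuitCost.
Variables (F : fieldType) (n : nat).
Local Notation P := {mpoly F[n]}.
Implicit Types (ps qs : seq P) (p q : P).

Definition reach s ps := exists2 prog : seq (gate F n),
  (slp_wf 0 prog && (size prog <= s)%N) & {subset ps <= slp_vals prog}.

(** Quantifying over every [qs] containing [ps] keeps the estimate valid after further gates, so the
    costs of subterms simply add up. *)
Definition derivable c ps q :=
  forall s qs, {subset ps <= qs} -> reach s qs -> reach (s + c) (q :: qs).

Lemma reach_gate s ps q : reach s ps ->
  (forall prog, slp_wf 0 prog -> {subset ps <= slp_vals prog} -> exists2 g : gate F n,
     gate_wf (size prog) g & gate_val (slp_vals prog) g = q) ->
  reach (s + 1) (q :: ps).
Proof.
case=> prog /andP[wf sz] sub /(_ prog wf sub)[g' wg gq].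
exists (rcons prog g'); first by rewrite slp_wf_rcons wf wg size_rcons addn1.
by move=> x; rewrite inE slp_vals_rcons gq mem_rcons inE => /predU1P[->|/sub ->]; rewrite ?eqxx ?orbT.
Qed.

Lemma reach_le s s' ps : (s <= s')%N -> reach s ps -> reach s' ps.
Proof.
by move=> ss' [prog /andP[wf sz] sub]; exists prog => //; rewrite wf (leq_trans sz).
Qed.

Lemma reach_sub s ps qs : {subset qs <= ps} -> reach s ps -> reach s qs.
Proof. by move=> sub [prog ok H]; exists prog => // x /sub/H. Qed.

Lemma derivable_le c c' ps q : (c <= c')%N -> derivable c ps q -> derivable c' ps q.
Proof. by move=> cc' D s qs sub R; apply: reach_le (D s qs sub R); rewrite leq_add2l. Qed.

Lemma derivable_mem ps q : q \in ps -> derivable 0 ps q.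
Proof.
move=> qps s qs sub; rewrite addn0; apply: reach_sub => x.
by rewrite inE => /predU1P[->|//]; apply: sub.
Qed.

Lemma derivable_const ps c : derivable 1 ps c%:MP.
Proof. by move=> s qs _ /reach_gate; apply=> // prog _ _; exists (GConst n c). Qed.

Lemma derivable_var ps i : derivable 1 ps 'X_i.
Proof. by move=> s qs _ /reach_gate; apply=> // prog _ _; exists (GVar F i). Qed.

Lemma derivable_op (op : P -> P -> P) (G : nat -> nat -> gate F n) :
  (forall k i j, gate_wf k (G i j) = (i < k)%N && (j < k)%N) ->
  (forall acc i j, gate_val acc (G i j) = op acc`_i acc`_j) ->
  forall c d ps p q, derivable c ps p -> derivable d ps q -> derivable (c + d + 1) ps (op p q).
Proof.
move=> Gwf Gval c d ps p q Dp Dq s qs sub R.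
have R1 := Dp s qs sub R.
have R2 := Dq _ (p :: qs) (fun x xps => @mem_behead _ (p :: qs) x (sub x xps)) R1.
rewrite !addnA; apply: (@reach_sub _ (op p q :: q :: p :: qs)).
  by move=> x; rewrite !inE => /orP[->|->]; rewrite ?orbT.
apply: reach_gate R2 _ => // prog _ sub'.
have /(nthP 0)[i ip Ei] : p \in slp_vals prog by apply: sub'; rewrite !inE eqxx orbT.
have /(nthP 0)[j jp Ej] : q \in slp_vals prog by apply: sub'; rewrite !inE eqxx.
by exists (G i j); rewrite ?Gwf ?Gval ?Ei ?Ej // -!(size_slp_vals prog) ip jp.
Qed.

Lemma derivable_add c d ps p q :
  derivable c ps p -> derivable d ps q -> derivable (c + d + 1) ps (p + q).
Proof. exact: (@derivable_op +%R (@GAdd F n)). Qed.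

Lemma derivable_mul c d ps p q :
  derivable c ps p -> derivable d ps q -> derivable (c + d + 1) ps (p * q).
Proof. exact: (@derivable_op *%R (@GMul F n)). Qed.

Lemma derivable_big (op : P -> P -> P) (x0 : F) c ps (T : Type) (r : seq T) (Q : pred T)
    (G : T -> P) :
  (forall c d ps p q, derivable c ps p -> derivable d ps q -> derivable (c + d + 1) ps (op p q)) ->
  (forall t, Q t -> derivable c ps (G t)) ->
  derivable (1 + size r * c.+1) ps (\big[op/x0%:MP]_(t <- r | Q t) G t).
Proof.
move=> Dop DG; elim: r => [|t r IH]; first by rewrite big_nil; apply: derivable_const.
rewrite big_cons /=; case: ifP => [Qt|_].
  apply: derivable_le (Dop _ _ _ _ _ (DG t Qt) IH); lia.
apply: derivable_le IH; lia.
Qed.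

Lemma derivable_sum c ps (T : finType) (Q : pred T) (G : T -> P) :
  (forall t, Q t -> derivable c ps (G t)) -> derivable (1 + #|T| * c.+1) ps (\sum_(t | Q t) G t).
Proof.
move=> DG; have := @derivable_big _ 0 c ps T (index_enum T) Q G derivable_add DG.
by rewrite mpolyC0 -[index_enum T]enumT -cardT.
Qed.

Lemma derivable_prod c ps (T : finType) (Q : pred T) (G : T -> P) :
  (forall t, Q t -> derivable c ps (G t)) -> derivable (1 + #|T| * c.+1) ps (\prod_(t | Q t) G t).
Proof.
move=> DG; have := @derivable_big _ 1 c ps T (index_enum T) Q G derivable_mul DG.
by rewrite mpolyC1 -[index_enum T]enumT -cardT.
Qed.

Lemma reach_family c s ps qs : (forall q, q \in qs -> derivable c ps q) ->
  reach s ps -> reach (s + size qs * c) qs.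
Proof.
move=> D R; suff : reach (s + size qs * c) (qs ++ ps).
  by apply: reach_sub => x xq; rewrite mem_cat xq.
elim: qs D => [|q qs IH] D; first by rewrite addn0.
have {}IH : reach (s + size qs * c) (qs ++ ps).
  by apply: IH => x xq; apply: D; rewrite inE xq orbT.
rewrite /= mulSn addnCA [(c + _)%N]addnC; apply: (D q) => //; first by rewrite inE eqxx.
by move=> x xp; rewrite mem_cat xp orbT.
Qed.

(** The output has to be the last gate, so the constant 0 and the sum of f with it are appended. *)
Lemma reach_computes s ps f : reach s ps -> f \in ps ->
  exists2 prog : seq (gate F n), (size prog <= s + 2)%N & computes prog f.
Proof.
case=> prog /andP[wf sz] sub /sub/(nthP 0)[i ip Ei]; rewrite size_slp_vals in ip.
exists (rcons (rcons prog (GConst n 0)) (GAdd F n i (size prog))).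
  by rewrite !size_rcons addn2.
split; first by rewrite size_rcons.
  by rewrite !slp_wf_rcons wf size_rcons /= !ltnS (ltnW ip) leqnn.
rewrite !slp_vals_rcons last_rcons /= !nth_rcons !size_slp_vals ip ltnn eqxx mpolyC0 addr0.
exact: Ei.
Qed.

End CircuitCost.

Section TreeCircuit.
Variables (V0 V1 V2 : finType) (e0 : rel V0) (e1 : rel V1) (e2 : rel V2).
Variables (vl0 vr0 : V0) (vl1 vr1 vp1 : V1) (vl2 vr2 vp2 : V2) (cmax : nat).
Variables (F : fieldType) (n : nat) (W : finType) (w0 : W) (w : W -> W -> {mpoly F[n]}).
Hypothesis Dw : forall a b ps, derivable 1 ps (w a b).
Local Notation S := (gS V0 V1 V2).
Local Notation Nst := #|{ffun S -> W}|.
Local Notation gw := (gadget_weight e0 e1 e2 w0 w).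
Local Notation lw := (link_weight vl0 vr0 vl1 vr1 vp1 vl2 vr2 vp2 cmax w).

Definition gadget_cost := (1 + #|S| * (1 + #|S| * 2).+1)%N.
Definition path_cost := (1 + gq cmax * (1 + 1 + 1 + (1 + gq cmax * 2) + 1).+1)%N.
Definition link_cost := (1 + #|W| ^ gq cmax * path_cost.+1)%N.
Definition node_cost :=
  (gadget_cost + ((1 + Nst * (link_cost + 0 + 1).+1) + (1 + Nst * (link_cost + 0 + 1).+1) + 1) + 1)%N.

Lemma derivable_gadget ps k s : derivable gadget_cost ps (gw k s).
Proof.
rewrite /gadget_weight; case: ifP => _.
  by apply: derivable_prod => x _; apply: derivable_prod => y _; apply: Dw.
by rewrite -mpolyC0; apply: (derivable_le _ (@derivable_const F n ps 0)); rewrite leq_addr.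
Qed.

Lemma derivable_link ps k s s' : derivable link_cost ps (lw k s s').
Proof.
have D1 q : derivable 1 ps (if q is Some (a, b) then w a b else 1).
  by case: q => [[a b]|]; [apply: Dw | rewrite -mpolyC1; apply: derivable_const].
rewrite /link_cost -[in (#|W| ^ _)%N](card_ord (gq cmax)) -card_ffun.
apply: derivable_sum => p _; rewrite /path_cost -[in X in (1 + X * _)%N](card_ord (gq cmax)).
apply: derivable_prod => j _; apply: derivable_mul; first apply: derivable_mul.
- case: ifP => _; first exact: Dw.
  exact: (D1 None).
- case: ifP => _; first exact: Dw.
  exact: (D1 None).
rewrite -[in X in (1 + X * _)%N](card_ord (gq cmax)).
by apply: derivable_prod => j' _; apply: Dw.
Qed.

(** A dynamic programming table. The bound on k doubles when f drops by one, so both children of an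
    entry lie in the preceding table. *)
Definition level_vals L f := [seq tree_val lw gw f k s | k <- iota 0 (2 ^ (L.+1 - f)), s <- enum {: {ffun S -> W}}].

Lemma mem_level_vals L f k s : (k < 2 ^ (L.+1 - f))%N -> tree_val lw gw f k s \in level_vals L f.
Proof. by move=> kL; apply: allpairs_f; rewrite ?mem_iota ?mem_enum. Qed.

Lemma reach_level L f : (f <= L)%N ->
  reach (f.+1 * (2 ^ L.+1 * Nst * node_cost)) (level_vals L f).
Proof.
have sz g : (size (level_vals L g) <= 2 ^ L.+1 * Nst)%N.
  by rewrite size_allpairs size_iota -cardT leq_mul2r leq_exp2l // leq_subr orbT.
elim: f => [|f IH] fL.
  have R0 : @reach F n 0 [::] by exists [::].
  have D q : q \in level_vals L 0 -> derivable node_cost [::] q.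
    case/allpairsP=> -[k s] /= [_ _ ->]; rewrite mulr1.
    by apply: (derivable_le _ (@derivable_gadget [::] k s)); rewrite /node_cost -addnA leq_addr.
  by apply: reach_le (reach_family D R0); rewrite add0n mul1n leq_mul2r sz orbT.
have {}IH := IH (ltnW fL).
have D q : q \in level_vals L f.+1 -> derivable node_cost (level_vals L f) q.
  case/allpairsP=> -[k s] /= [+ _ ->]; rewrite mem_iota add0n => /= kL.
  have EL : (2 ^ (L.+1 - f) = 2 * 2 ^ (L.+1 - f.+1))%N by rewrite -expnS subnS prednK // subn_gt0 leqW.
  apply: derivable_mul; first exact: derivable_gadget.
  by apply: derivable_mul; apply: derivable_sum => s' _; apply: derivable_mul;
    (try exact: derivable_link); apply: derivable_mem; apply: mem_level_vals; rewrite EL; lia.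
apply: reach_le (reach_family D IH).
by rewrite [in leqRHS]mulSn addnC leq_add2r leq_mul2r sz orbT.
Qed.

Lemma tree_circuit L : exists2 prog : seq (gate F n),
  (size prog <= L.+1 * (2 ^ L.+1 * Nst * node_cost) + (1 + Nst) + 2)%N &
  computes prog (\sum_s tree_val lw gw L 1 s).
Proof.
have R := reach_level (leqnn L).
have D : derivable (1 + Nst * 1) (level_vals L L) (\sum_s tree_val lw gw L 1 s).
  apply: derivable_sum => s _; apply: derivable_mem; apply: mem_level_vals.
  by rewrite subSnn.
have := D _ _ (fun x xl => xl) R; rewrite muln1 => /reach_computes; apply.
exact: mem_head.
Qed.

End TreeCircuit.

(** * Layered circuits as homomorphism sums *)

Section GadgetInstance.
Variables (V0 V1 V2 : finType) (e0 : rel V0) (e1 : rel V1) (e2 : rel V2).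
Variables (vl0 vr0 : V0) (vl1 vr1 vp1 : V1) (vl2 vr2 vp2 : V2) (cmax : nat).
Hypotheses (s0 : simple_graph e0) (s1 : simple_graph e1) (s2 : simple_graph e2)
  (c0 : connected e0) (c1 : connected e1) (c2 : connected e2)
  (r0 : rigid e0) (r1 : rigid e1) (r2 : rigid e2)
  (i01 : incomparable e0 e1) (i02 : incomparable e0 e2) (i12 : incomparable e1 e2)
  (hc0 : (#|V0| < cmax)%N) (hc1 : (#|V1| < cmax)%N) (hc2 : (#|V2| < cmax)%N)
  (d0 : vl0 != vr0)
  (d1 : [&& vl1 != vr1, vl1 != vp1 & vr1 != vp1])
  (d2 : [&& vl2 != vr2, vl2 != vp2 & vr2 != vp2]).

Local Notation S := (gS V0 V1 V2).
Local Notation eS := (geS e0 e1 e2).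
Local Notation tag := (@gtag V0 V1 V2).

(** I_1 has three distinguished vertices; consequently every connecting path has interior
    vertices. *)
Lemma cmax_gt3 : (3 < cmax)%N.
Proof.
apply: leq_trans hc1; rewrite ltnS.
case/and3P: d1 => lr lp rp; have E : #|[set vl1; vr1; vp1]| = 3%N.
  by rewrite -setUA cardsU1 cards2 !inE negb_or lr lp /= rp.
by rewrite -E max_card.
Qed.

Lemma connect_image (T : finType) (e : rel T) (f : T -> S) :
  (forall x y, e x y -> eS (f x) (f y)) -> forall x y, connect e x y -> connect eS (f x) (f y).
Proof.
move=> ef x y /connectP[p]; elim: p x => [x _ -> //|z p IH x /= /andP[xz pz] yl].
by apply: connect_trans (connect1 (ef _ _ xz)) (IH _ pz yl).
Qed.

Lemma restrict_hom (T T' : finType) (e : rel T) (e' : rel T') (f : T -> S) (f' : T' -> S)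
    (phi : S -> S) :
  (forall x y, eS (f' x) (f' y) = e' x y) ->
  (forall x y, e x y -> eS (phi (f x)) (phi (f y))) ->
  (forall x, exists y, phi (f x) = f' y) ->
  exists2 psi : T -> T', is_hom e e' psi & forall x, phi (f x) = f' (psi x).
Proof.
move=> He' Hphi /(@fin_all_exists T (fun _ => T'))[psi Hpsi].
by exists psi => // x y xy; rewrite -He' -!Hpsi Hphi.
Qed.

Lemma tag0P z : tag z = 0%N -> exists y, z = inl y.
Proof. by case: z => [y|[]] //; exists y. Qed.
Lemma tag1P z : tag z = 1%N -> exists y, z = inr (inl y).
Proof. by case: z => [|[y|]] //; exists y. Qed.
Lemma tag2P z : tag z = 2%N -> exists y, z = inr (inr y).
Proof. by case: z => [|[|y]] //; exists y. Qed.

(** Of the nine pairs (i, j) in [gd_rigid], the diagonal ones are rigidity and the others contradict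
    incomparability. *)
Lemma gadgets_gS : gadgets eS tag (gatt vl0 vr0 vl1 vr1 vl2 vr2)
  (@gpv V0 V1 V2 vl0 vp1 vp2) (gq cmax).
Proof.
have c3 := cmax_gt3.
split.
- exact: geS_sym.
- exact: geS_irr.
- exact: geS_tag.
- move=> [x|[x|x]] [y|[y|y]] // _.
  + exact: (@connect_image _ e0 inl).
  + exact: (@connect_image _ e1 (inr \o inl)).
  + exact: (@connect_image _ e2 (inr \o inr)).
- move=> i j phi; case: i => [|[|[|//]]]; case: j => [|[|[|//]]] _ _ hom tg.
  + have [//||x|psi hpsi E [x|[]] // _] := @restrict_hom _ _ e0 e0 inl inl phi.
    * by move=> x y; apply: (hom (inl x) (inl y) erefl).
    * exact/tag0P/tg.
    by rewrite E r0.
  + have [//||x|psi /(i01.1) []] := @restrict_hom _ _ e0 e1 inl (inr \o inl) phi.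
    * by move=> x y; apply: (hom (inl x) (inl y) erefl).
    * exact/tag1P/tg.
  + have [//||x|psi /(i02.1) []] := @restrict_hom _ _ e0 e2 inl (inr \o inr) phi.
    * by move=> x y; apply: (hom (inl x) (inl y) erefl).
    * exact/tag2P/tg.
  + have [//||x|psi /(i01.2) []] := @restrict_hom _ _ e1 e0 (inr \o inl) inl phi.
    * by move=> x y; apply: (hom (inr (inl x)) (inr (inl y)) erefl).
    * exact/tag0P/tg.
  + have [//||x|psi hpsi E [|[x|]] // _] := @restrict_hom _ _ e1 e1 (inr \o inl) (inr \o inl) phi.
    * by move=> x y; apply: (hom (inr (inl x)) (inr (inl y)) erefl).
    * exact/tag1P/tg.
    by rewrite [LHS]E /= r1.
  + have [//||x|psi /(i12.1) []] := @restrict_hom _ _ e1 e2 (inr \o inl) (inr \o inr) phi.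
    * by move=> x y; apply: (hom (inr (inl x)) (inr (inl y)) erefl).
    * exact/tag2P/tg.
  + have [//||x|psi /(i02.2) []] := @restrict_hom _ _ e2 e0 (inr \o inr) inl phi.
    * by move=> x y; apply: (hom (inr (inr x)) (inr (inr y)) erefl).
    * exact/tag0P/tg.
  + have [//||x|psi /(i12.2) []] := @restrict_hom _ _ e2 e1 (inr \o inr) (inr \o inl) phi.
    * by move=> x y; apply: (hom (inr (inr x)) (inr (inr y)) erefl).
    * exact/tag1P/tg.
  + have [//||x|psi hpsi E [|[|x]] // _] := @restrict_hom _ _ e2 e2 (inr \o inr) (inr \o inr) phi.
    * by move=> x y; apply: (hom (inr (inr x)) (inr (inr y)) erefl).
    * exact/tag2P/tg.
    by rewrite [LHS]E /= r2.
- by move=> [x|[x|x]].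
- have sm (T : finType) (f : T -> S) i : (#|T| < cmax)%N ->
      (forall z, tag z = i -> exists y, z = f y) -> (#|[pred x | tag x == i]| < (gq cmax).+2)%N.
    move=> Tc fP; rewrite /gq -[(cmax - 2).+2]addn2 subnK ?(ltnW (ltnW c3)) //.
    apply: leq_ltn_trans Tc; rewrite -(size_codom f).
    apply: leq_trans (card_size (codom f)); apply: subset_leq_card.
    by apply/subsetP => z /eqP/fP[y ->]; apply: codom_f.
  case=> [|[|[|i]]].
  + exact: (sm _ _ _ hc0 tag0P).
  + exact: (sm _ _ _ hc1 tag1P).
  + exact: (sm _ _ _ hc2 tag2P).
  + by rewrite eq_card0 // => -[x|[x|x]].
- by move=> b i; apply: tag_gatt.
- by move=> i; apply: tag_gpv.
- have [/and3P[n1 _ _] /and3P[n2 _ _]] := (d1, d2).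
  move=> b b' [|[|[|//]]] _; case: b b' => [] [] // [E].
  + by move: d0; rewrite E eqxx.
  + by move: d0; rewrite E eqxx.
  + by move: n1; rewrite E eqxx.
  + by move: n1; rewrite E eqxx.
  + by move: n2; rewrite E eqxx.
  + by move: n2; rewrite E eqxx.
- have [/and3P[_ n1 n1'] /and3P[_ n2 n2']] := (d1, d2).
  move=> b [|[|[|//]]] _ // _; apply/eqP; case: b => -[E].
  + by move: n1'; rewrite E eqxx.
  + by move: n1; rewrite E eqxx.
  + by move: n2'; rewrite E eqxx.
  + by move: n2; rewrite E eqxx.
by rewrite /gq subn_gt0 (ltnW c3).
Qed.

End GadgetInstance.

Section LayerWeights.
Variables (F : fieldType) (n : nat) (I : finType).
Implicit Types wt : nat -> bool -> I -> I -> F + 'I_n.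

Fixpoint layer_val wt f : I -> {mpoly F[n]} :=
  if f is f'.+1 then fun g =>
    lincomb (wt f' false g) (layer_val wt f') * lincomb (wt f' true g) (layer_val wt f')
  else fun=> 1.

Lemma eq_layer_val wt wt' f : (forall k, (k < f)%N -> wt k = wt' k) ->
  layer_val wt f =1 layer_val wt' f.
Proof.
elim: f => //= f IH E g; rewrite !E //; congr (_ * _); apply: eq_bigr => h _;
  by rewrite IH // => k kf; rewrite E // ltnW.
Qed.

Lemma layered_weights L p : layered L p -> exists wt, layer_val wt L =1 p.
Proof.
elim=> [p' p1|L' p' q w _ [wt E] Hq].
  by exists (fun _ _ _ _ => inl 0) => g; rewrite p1.
exists (fun k => if k == L' then w else wt k) => g /=.
have E' : layer_val (fun k => if k == L' then w else wt k) L' =1 p'.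
  by move=> h; rewrite -E; apply: eq_layer_val => k kL; rewrite ltn_eqF.
rewrite Hq eqxx; congr (_ * _); apply: eq_bigr => h _; by rewrite E'.
Qed.
End LayerWeights.

Lemma sum_codom (R : nmodType) (A B : finType) (h : A -> B) (G : B -> R) :
  injective h -> (forall b, G b != 0 -> exists a, b = h a) ->
  \sum_b G b = \sum_a G (h a).
Proof.
move=> hi H; rewrite (bigID (fun b => b \in codom h)) /= [X in _ + X]big1 ?addr0; last first.
  by move=> b nb; apply/eqP; apply: contraR nb => /H[a ->]; apply: codom_f.
by rewrite -big_uniq ?big_image //= map_inj_uniq ?enum_uniq.
Qed.

Section Encoding.
Variables (V0 V1 V2 : finType) (e0 : rel V0) (e1 : rel V1) (e2 : rel V2).
Variables (vl0 vr0 : V0) (vl1 vr1 vp1 : V1) (vl2 vr2 vp2 : V2) (cmax : nat).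
Local Notation S := (gS V0 V1 V2).
Local Notation eS := (geS e0 e1 e2).
Local Notation tag := (@gtag V0 V1 V2).
Local Notation gq := (gq cmax).
Local Notation att := (gatt vl0 vr0 vl1 vr1 vl2 vr2).
Local Notation pv := (@gpv V0 V1 V2 vl0 vp1 vp2).
Hypothesis gd : gadgets eS tag att pv gq.

Variables (F : fieldType) (n L r : nat) (I : finType) (g0 : I).
Variable wt : nat -> bool -> I -> I -> F + 'I_n.

Local Notation J := (jvert S gq I L r).
Local Notation jarc := (@jarc S eS tag att pv gq I L r).
Local Notation adj := (@jadj S eS tag att pv gq I L r).
Local Notation copy := (@copy S gq I L r).
Local Notation pint := (@pint S gq I L r).

(* Layers are counted from the leaves, copies from the root. *)
Definition arc_weight (x y : J) : F + 'I_n :=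
  if (x, y) is (inl (inl _), inl (inr ((d, b, g, h), _))) then wt (L - d.+1) b g h
  else inl 1.

(** The value 0 on non-edges is what cuts the target graph out of the complete graph. *)
Definition jweight (x y : J) : F + 'I_n :=
  if jarc x y then arc_weight x y else if jarc y x then arc_weight y x else inl 0.

Lemma first_last_arc (c : 'I_L.+1 * I) s s' (p : 'I_L * bool * I * I) j : first_arc att c s p j -> last_arc pv gq c s' p j = false.
Proof.
case: p => [[[d b] g] h] /and4P[/eqP cd _ _ _]; apply/negP => /and4P[/eqP cd' _ _ _].
by move: cd'; rewrite cd => /eqP; rewrite ltn_eqF.
Qed.

(** An edge that is an arc in both directions lies inside a copy, where both weights are 1. *)
Lemma jweight_sym x y : jweight x y = jweight y x.
Proof.
rewrite /jweight; case xy: (jarc x y); case yx: (jarc y x) => //.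
case: x y xy yx => [[[c s]|[p j]]|x] [[[c' s']|[p' j']]|y] //=.
  by move/first_last_arc => ->.
by move=> A /first_last_arc E; move: A; rewrite E.
Qed.

Definition jw x y : {mpoly F[n]} := subst_var (jweight x y).

Lemma jw_adj x y : jw x y != 0 -> adj x y.
Proof.
rewrite /jw /jweight /adj; case: (jarc x y) => //=; case: (jarc y x) => //=.
by rewrite mpolyC0 eqxx.
Qed.

Lemma jw_sym x y : jw x y = jw y x.
Proof. by rewrite /jw jweight_sym. Qed.

Lemma jw_arc x y : jarc x y -> jw x y = subst_var (arc_weight x y).
Proof. by rewrite /jw /jweight => ->. Qed.

Definition j0 : J := copy (ord0, g0) (att true 0).
Definition embed (i : nat) (c : 'I_L.+1 * I) : {ffun S -> J} :=
  [ffun x => if tag x == i then copy c x else j0].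

Local Notation gwt := (gadget_weight e0 e1 e2 j0 jw).
Local Notation lwt := (link_weight vl0 vr0 vl1 vr1 vp1 vl2 vr2 vp2 cmax jw).

Lemma embed_inj i c c' : (i < 3)%N -> embed i c = embed i c' -> c = c'.
Proof.
move=> i3 /ffunP/(_ (att true i)); rewrite !ffunE (gd_att gd) // eqxx.
by case.
Qed.

Lemma gadget_weight_neq0 k (s : {ffun S -> J}) : (0 < k)%N -> gwt k s != 0 ->
  exists2 c : 'I_L.+1 * I, ltype c.1 = gtype k & s = embed (gtype k) c.
Proof.
move=> k0; rewrite /gadget_weight k0 /=; case: ifP => [/forallP def|_]; last by rewrite eqxx.
move=> /prodf_neq0 nz.
have [|x y tx xy|c tc Hc] := @gadget_hom _ _ _ _ _ _ gd I g0 L r (gtype k) s.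
- exact: ltype_lt3.
- have hom u v : tag u = gtype k -> eS u v -> (enum_rank u < enum_rank v)%N -> adj (s u) (s v).
    move=> tu uv ruv; apply: jw_adj.
    have /prodf_neq0 := nz u (introT eqP tu); apply.
    by rewrite uv.
  have [/(hom _ _ tx xy) //|] := boolP (enum_rank x < enum_rank y)%N.
  rewrite enum_rank_lt; last by apply/eqP => E; move: xy; rewrite E (gd_irr gd).
  rewrite negbK => ryx; rewrite /jadj orbC; apply: hom => //; last by rewrite (gd_sym gd).
  by rewrite -(gd_tag gd xy).
exists c => //; apply/ffunP => x; rewrite ffunE; case: eqP => [/Hc //|/eqP/negbTE nx].
by have := def x; rewrite nx => /eqP.
Qed.

Lemma gadget_weight_embed k (c : 'I_L.+1 * I) : (0 < k)%N -> ltype c.1 = gtype k ->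
  gwt k (embed (gtype k) c) = 1.
Proof.
move=> k0 tc; rewrite /gadget_weight k0 /=; case: ifP => [_|/forallP[] x]; last first.
  by rewrite ffunE; case: eqP => //=; rewrite eqxx.
rewrite big1 // => x tx; rewrite big1 // => y /andP[xy _]; rewrite !ffunE -(gd_tag gd xy) tx.
by rewrite jw_arc /= ?mpolyC1 // eqxx xy tc tx.
Qed.

Lemma gtype_parent k : (1 < k)%N -> gtype k != gtype k./2.
Proof. by move=> k1; rewrite !gtypeE trunc_log2S // ltypeS_neq. Qed.

(** By [walk_copies] at most one interior has nonzero weight, the connecting path itself, and of its
    edges only the first carries a weight other than the constant 1 given to the rest. *)
Lemma link_weight_embed k (c c' : 'I_L.+1 * I) : (1 < k)%N ->
  ltype c.1 = gtype k./2 -> ltype c'.1 = gtype k ->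
  lwt k (embed (gtype k./2) c) (embed (gtype k) c') =
  if c'.1 == c.1.+1 :> nat then subst_var (wt (L - c'.1) (odd k) c.2 c'.2) else 0.
Proof.
move=> k1 tc tc'.
have gq0 := gd_gq gd.
have -> : lwt k (embed (gtype k./2) c) (embed (gtype k) c') =
    \sum_(p : {ffun 'I_gq -> J}) path_weight jw (copy c (att (odd k) (ltype c.1)))
       (copy c' (pv (ltype c'.1))) p.
  rewrite tc tc'; apply: eq_bigr => p _.
  have ea : embed (gtype k./2) c (att (odd k) (gtype k./2)) = copy c (att (odd k) (gtype k./2)).
    by rewrite ffunE (gd_att gd _ (ltype_lt3 _)) eqxx.
  have ep : embed (gtype k) c' (pv (gtype k)) = copy c' (pv (gtype k)).
    by rewrite ffunE (gd_pv gd (ltype_lt3 _)) eqxx.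
  by rewrite ea ep.
set a := copy c _; set b := copy c' _.
have c'c : c' != c.
  by apply/eqP => E; have := gtype_parent k1; rewrite -tc -tc' E eqxx.
have walk (p : {ffun 'I_gq -> J}) : path_weight jw a b p != 0 ->
    exists2 d : 'I_L, d = c.1 :> nat & c'.1 = d.+1 :> nat /\
      p = [ffun j => pint (d, odd k, c.2, c'.2) j].
  move=> /prodf_neq0 nz.
  pose x t := if t == 0%N then a else if insub t.-1 is Some j then p j else b.
  have xS (j : 'I_gq) : x j.+1 = p j by rewrite /x /= valK.
  have xe : x gq.+1 = b by rewrite /x /= insubN // ltnn.
  have [t tq|d Ed [E1 E2 E3]] := walk_copies gd c'c (erefl : x 0%N = a) xe.
    apply: jw_adj; case: t tq => [_|t tq].
      have := nz (Ordinal gq0) isT; rewrite !mulf_eq0 !negb_or -andbA => /and3P[+ _ _].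
      by rewrite -(xS (Ordinal gq0)).
    have := nz (Ordinal tq) isT; rewrite !mulf_eq0 !negb_or -andbA => /and3P[_].
    rewrite (xS (Ordinal tq)) /=; have [E H _|ne _] := eqVneq t.+1 gq.
      by rewrite E xe.
    have lt : (t.+1 < gq)%N by rewrite ltn_neqAle ne.
    by move=> /prodf_neq0/(_ (Ordinal lt) (eqxx _)); rewrite (xS (Ordinal lt)).
  by exists d => //; split => //; apply/ffunP => j; rewrite ffunE -E3 xS.
case: eqP => [E|ne]; last first.
  rewrite big1 // => p _; apply/eqP/negPn/negP => /walk[d Ed [E _]].
  by case: ne; rewrite E Ed.
have dL : (c.1 < L)%N by rewrite -ltnS -E ltn_ord.
pose d := Ordinal dL; pose p0 : {ffun 'I_gq -> J} := [ffun j => pint (d, odd k, c.2, c'.2) j].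
rewrite (bigD1 p0) //= [X in _ + X]big1 ?addr0; last first.
  move=> p np; apply/eqP; apply: contraR np => /walk[d' Ed' [_ ->]]; apply/eqP.
  by congr finfun; rewrite (_ : d' = d) //; apply: val_inj.
rewrite /path_weight (bigD1 (Ordinal gq0)) //= [X in _ * X]big1 ?mulr1; last first.
  move=> j /negbTE nj; rewrite -[_ == 0%N]/(j == Ordinal gq0) nj mul1r.
  case: eqP => [jq|_]; last rewrite mul1r.
    rewrite ffunE jw_arc /= ?mpolyC1 ?mul1r; last by rewrite E !eqxx jq /= eqxx.
    by rewrite big_pred0 // => j'; rewrite jq ltn_eqF.
  by rewrite big1 // => j' /eqP jj'; rewrite !ffunE jw_arc /= ?mpolyC1 // jj' !eqxx.
rewrite !ffunE [X in _ * X]big1 ?mulr1; last first.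
  by move=> j' /eqP jj'; rewrite !ffunE jw_arc /= ?mpolyC1 // jj' !eqxx.
rewrite jw_arc /=; last by rewrite !eqxx.
rewrite E; case: eqP => [jq|_]; last by rewrite mulr1.
by rewrite jw_arc /= ?mpolyC1 ?mulr1 // E !eqxx jq /= eqxx.
Qed.

(** A nonzero gadget weight fixes only the gadget type of the copy, which many levels share; the
    nonzero link weight then forces the level just below that of [c]. *)
Lemma sum_children f k (c : 'I_L.+1 * I) : (1 < k)%N -> (f + trunc_log 2 k = L)%N ->
  c.1 = trunc_log 2 k./2 :> nat ->
  (forall c' : 'I_L.+1 * I, c'.1 = trunc_log 2 k :> nat ->
     tree_val lwt gwt f k (embed (gtype k) c') = layer_val wt f c'.2) ->
  \sum_s lwt k (embed (gtype k./2) c) s * tree_val lwt gwt f k s =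
  lincomb (wt f (odd k) c.2) (layer_val wt f).
Proof.
move=> k1 kL ck IH; have k0 := ltnW k1.
have lk := trunc_log2S k1.
have tc : ltype c.1 = gtype k./2 by rewrite ck.
have lL : (trunc_log 2 k < L.+1)%N by rewrite ltnS -kL leq_addl.
pose h g := embed (gtype k) (Ordinal lL, g).
rewrite (sum_codom (h := h)); first last.
- move=> s; rewrite mulf_eq0 negb_or => /andP[nl nt].
  have [c' tc' Es] := gadget_weight_neq0 k0 (tree_val_neq0 nt).
  move: nl; rewrite Es link_weight_embed //; case: ifP => [/eqP E _|_ /eqP //].
  exists c'.2; congr embed; rewrite [LHS]surjective_pairing; congr (_, _).
  by apply: val_inj; rewrite /= E ck lk.
- by move=> g g' /embed_inj-/(_ (ltype_lt3 _))[].
apply: eq_bigr => g _; rewrite link_weight_embed // IH //= {1}lk ck eqxx.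
by have -> : (L - trunc_log 2 k)%N = f by rewrite -[X in (X - _)%N]kL addnK.
Qed.

Lemma tree_val_embed f k (c : 'I_L.+1 * I) : (0 < k)%N -> (f + trunc_log 2 k = L)%N ->
  c.1 = trunc_log 2 k :> nat ->
  tree_val lwt gwt f k (embed (gtype k) c) = layer_val wt f c.2.
Proof.
elim: f k c => [|f IH] k c k0 kL ck.
  by rewrite /= gadget_weight_embed ?mulr1 // ck.
have child k' : (1 < k')%N -> k'./2 = k ->
    \sum_s lwt k' (embed (gtype k) c) s * tree_val lwt gwt f k' s =
    lincomb (wt f (odd k') c.2) (layer_val wt f).
  move=> k'1 k'k; have k'L : (f + trunc_log 2 k' = L)%N.
    by rewrite trunc_log2S // k'k addnS -addSn.
  rewrite -k'k; apply: sum_children => // [|c' ck']; first by rewrite k'k.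
  by apply: IH => //; exact: ltnW.
have k1 : (1 < k.*2)%N by case: (k) k0 => // k2 _; rewrite doubleS.
rewrite tree_valS gadget_weight_embed // ?mul1r; last by rewrite ck.
by rewrite (child _ k1 (doubleK k)) (child _ (leqW k1) (uphalf_double k)) /= odd_double.
Qed.

(** Copies of I_0 have edges at level 0 only, so the root is sent to level 0, and the levels below
    are then determined. *)
Lemma graph_sum_layers : simple_graph e0 -> simple_graph e1 -> simple_graph e2 ->
  graph_sum e0 e1 e2 vl0 vr0 vl1 vr1 vp1 vl2 vr2 vp2 cmax (2 ^ L) jw =
  \sum_g layer_val wt L g.
Proof.
move=> s0 s1 s2; rewrite (tree_of_graph_sum _ _ _ _ _ _ _ _ _ j0 s0 s1 s2 (gd_gq gd) jw_sym).
pose h g := embed (gtype 1) (ord0, g).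
rewrite (sum_codom (h := h)); first last.
- move=> s /tree_val_neq0/(@gadget_weight_neq0 1 _ isT)[c tc ->].
  exists c.2; congr embed; rewrite [LHS]surjective_pairing; congr (_, _).
  apply: val_inj => /=; move: tc; rewrite /ltype; case: eqP => // _.
  by rewrite gtypeE trunc_log1; case: ifP.
- by move=> g g' /embed_inj-/(_ isT)[].
by apply: eq_bigr => g _; rewrite tree_val_embed // trunc_log1 addn0.
Qed.

End Encoding.

Section Projection.
Variables (V0 V1 V2 : finType) (e0 : rel V0) (e1 : rel V1) (e2 : rel V2).
Variables (vl0 vr0 : V0) (vl1 vr1 vp1 : V1) (vl2 vr2 vp2 : V2) (cmax : nat).
Hypotheses (s0 : simple_graph e0) (s1 : simple_graph e1) (s2 : simple_graph e2).
Hypothesis gd : gadgets (geS e0 e1 e2) (@gtag V0 V1 V2) (gatt vl0 vr0 vl1 vr1 vl2 vr2)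
  (@gpv V0 V1 V2 vl0 vp1 vp2) (gq cmax).

Lemma layered_projection (F : fieldType) (n L N : nat) (I : finType) (g0 : I)
    (p : I -> {mpoly F[n]}) :
  layered L p ->
  (#|{: 'I_L.+1 * I * gS V0 V1 V2 + 'I_L * bool * I * I * 'I_(gq cmax)}| <= N)%N ->
  is_projection (\sum_g p g)
    (hom_poly F (@GE V0 V1 V2 e0 e1 e2 vl0 vr0 vl1 vr1 vp1 vl2 vr2 vp2 cmax (2 ^ L)) (@KE N)).
Proof.
move=> /layered_weights[wt Ewt] hN.
pose r := (N - #|{: 'I_L.+1 * I * gS V0 V1 V2 + 'I_L * bool * I * I * 'I_(gq cmax)}|)%N.
pose J := jvert (gS V0 V1 V2) (gq cmax) I L r.
have cardJ : #|J| = N by rewrite card_sum card_ord subnKC.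
pose h (a : 'I_N) : J := enum_val (cast_ord (esym cardJ) a).
have hbij : bijective h.
  exists (fun x => cast_ord cardJ (enum_rank x)) => [a|x].
    by rewrite /h enum_valK cast_ordKV.
  by rewrite /h cast_ordK enum_rankK.
pose w : J -> J -> F + 'I_n := jweight e0 e1 e2 vl0 vr0 vl1 vr1 vp1 vl2 vr2 vp2 wt.
have w_sym : forall a b : J, w a b = w b a by exact: jweight_sym.
have w0 (x : J) : subst_var (w x x) = 0 :> {mpoly F[n]}.
  rewrite /w /jweight; case E: (jarc _ _ _ _ _ _); last by rewrite /= mpolyC0.
  case: x E => [[[c s]|[q j]]|x] //= /andP[_].
    by rewrite (gd_irr gd) andbF.
  by rewrite ltn_eqF.
exists (fun j => w (h (enum_val j).1) (h (enum_val j).2)).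
rewrite (hom_poly_comp (w := fun a b => w (h a) (h b))) //.
- rewrite -(hom_sum_bij (h := h) _ (fun a b => subst_var (w a b))) //.
  apply: etrans (esym (graph_sum_layers gd L r g0 wt s0 s1 s2)).
  by apply: eq_bigr => g _; rewrite Ewt.
- exact: GE_sym s0 s1 s2 (gd_gq gd).
- exact: GE_irr s0 s1 s2 (gd_gq gd).
Qed.

End Projection.

(** * Completeness *)

Section Completeness.
Variables (V0 V1 V2 : finType) (e0 : rel V0) (e1 : rel V1) (e2 : rel V2).
Variables (vl0 vr0 : V0) (vl1 vr1 vp1 : V1) (vl2 vr2 vp2 : V2) (cmax : nat).
Hypotheses (s0 : simple_graph e0) (s1 : simple_graph e1) (s2 : simple_graph e2).
Hypothesis gd : gadgets (geS e0 e1 e2) (@gtag V0 V1 V2) (gatt vl0 vr0 vl1 vr1 vl2 vr2)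
  (@gpv V0 V1 V2 vl0 vp1 vp2) (gq cmax).
Local Notation GE m := (@GE V0 V1 V2 e0 e1 e2 vl0 vr0 vl1 vr1 vp1 vl2 vr2 vp2 cmax m).
Local Notation S := (gS V0 V1 V2).

Definition edge_var (F : fieldType) N (a b : 'I_N) : {mpoly F[#|{: 'I_N * 'I_N}|]} :=
  if a == b then 0 else 'X_(uvar a b).

Lemma hom_poly_graph_sum (F : fieldType) m N :
  hom_poly F (GE m) (@KE N) =
  graph_sum e0 e1 e2 vl0 vr0 vl1 vr1 vp1 vl2 vr2 vp2 cmax m (@edge_var F N).
Proof.
rewrite /graph_sum -(hom_sum_complete (w := @edge_var F N)).
- apply: eq_bigr => phi /forallP hom; apply: eq_bigr => q /andP[q12 _].
  by have /forallP/(_ q.2)/implyP/(_ q12) := hom q.1; rewrite /KE /edge_var => /negbTE ->.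
- exact: GE_sym s0 s1 s2 (gd_gq gd).
- exact: GE_irr s0 s1 s2 (gd_gq gd).
by move=> a; rewrite /edge_var eqxx.
Qed.

Lemma edge_varC (F : fieldType) N (a b : 'I_N) : edge_var F a b = edge_var F b a.
Proof. by rewrite /edge_var eq_sym uvarC. Qed.

Lemma derivable_edge_var (F : fieldType) N (a b : 'I_N) ps : derivable 1 ps (edge_var F a b).
Proof.
rewrite /edge_var; case: ifP => _; last exact: derivable_var.
by rewrite -mpolyC0; apply: derivable_const.
Qed.

Lemma hom_poly_in_VP (F : fieldType) :
  in_VP (@PFam F (fun n => #|{: 'I_(pow2up n ^ 6) * 'I_(pow2up n ^ 6)}|)
           (fun n => hom_poly F (GE (pow2up n)) (@KE (pow2up n ^ 6)))).
Proof.
have Pm : polyb pow2up by apply: (polyb_exp2_up_log polyb_id).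
have PN : polyb (fun n => pow2up n ^ 6)%N by apply: polyb_exp.
have PS k : polyb (fun n => #|'I_(pow2up n ^ 6)| ^ k)%N.
  by apply: polyb_le (polyb_exp k PN) => n; rewrite card_ord.
split; first split => /=; try apply: poly_bounded_of_polyb.
- by apply: polyb_le (polyb_mul PN PN) => n; rewrite card_prod !card_ord.
- apply: polyb_le (fun n => msize_hom_poly F _ _) _.
  have PV : polyb (fun n => #|GV V0 V1 V2 cmax (pow2up n)|).
    apply: (@polyb_le _ (fun n => 2 * pow2up n * #|S| + 2 * pow2up n * gq cmax)%N).
      move=> n; apply: leq_trans (leq_card val val_inj) _.
      by rewrite card_sum !card_prod !card_ord.
    by apply: polyb_add; repeat apply: polyb_mul; try exact: polyb_const.
  apply: polyb_add (polyb_const 1) _; apply: polyb_mul (polyb_const 3) _.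
  exact: polyb_mul.
pose Nst n := #|{ffun S -> 'I_(pow2up n ^ 6)}|.
have PNst : polyb Nst by apply: polyb_le (PS #|S|) => n; rewrite /Nst card_ffun.
pose s n := ((up_log 2 n).+1 * (2 ^ (up_log 2 n).+1 * Nst n *
  node_cost V0 V1 V2 cmax 'I_(pow2up n ^ 6)) + (1 + Nst n) + 2)%N.
exists s; split.
  apply: poly_bounded_of_polyb; rewrite /s.
  have Pc := polyb_const.
  apply: polyb_add (Pc 2); apply: polyb_add; last exact: polyb_add (Pc 1%N) PNst.
  apply: polyb_mul.
    by apply: polyb_le Pm => n; apply: ltn_expl.
  apply: polyb_mul; first apply: polyb_mul PNst.
    by apply: polyb_le (polyb_mul (Pc 2) Pm) => n; rewrite expnS.
  have Plink : polyb (fun n => link_cost cmax 'I_(pow2up n ^ 6)).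
    by apply: polyb_add (Pc 1%N) _; apply: polyb_mul (PS _) (Pc _).
  have Psum : polyb (fun n => 1 + Nst n * (link_cost cmax 'I_(pow2up n ^ 6) + 0 + 1).+1)%N.
    apply: polyb_add (Pc 1%N) _; apply: polyb_mul PNst _.
    by apply: (polyb_add (Pc 1%N)); do 2!apply: (fun H => polyb_add H (Pc _)).
  apply: polyb_add (Pc 1%N); apply: polyb_add (Pc _) _.
  by apply: polyb_add (Pc 1%N); apply: polyb_add.
move=> n.
have N0 : (0 < pow2up n ^ 6)%N by rewrite !expn_gt0.
have [prog sz cp] := @tree_circuit V0 V1 V2 e0 e1 e2 vl0 vr0 vl1 vr1 vp1 vl2 vr2 vp2 cmax F _ _
  (Ordinal N0) _ (@derivable_edge_var F (pow2up n ^ 6)) (up_log 2 n).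
exists prog; split => //=.
by rewrite hom_poly_graph_sum (tree_of_graph_sum _ _ _ _ _ _ _ _ _ (Ordinal N0) s0 s1 s2 (gd_gq gd) (@edge_varC _ _)).
Qed.

Lemma card_lstate_le a b D : (a <= b)%N ->
  (#|{: lstate ('I_a * 'I_D.+1)%type}| <=
   1 + (b * D.+1 * (b * D.+1).+1 + b * D.+1 * (b * D.+1) * (b * D.+1).+1))%N.
Proof.
move=> ab; rewrite card_option card_sum !card_prod !card_option !card_prod !card_ord add1n.
by rewrite ltnS; apply: leq_add; repeat apply: leq_mul; rewrite ?ltnS ?leq_mul.
Qed.

Lemma hom_poly_VP_hard (F : fieldType) (f : Defs.pfamily F) : in_VP f ->
  p_projection f (@PFam F (fun n => #|{: 'I_(pow2up n ^ 6) * 'I_(pow2up n ^ 6)}|)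
           (fun n => hom_poly F (GE (pow2up n)) (@KE (pow2up n ^ 6)))).
Proof.
case=> -[_ /polyb_of_poly_bounded PD] [s [/polyb_of_poly_bounded Ps Hprog]].
pose D n := msize (pf_poly f n).
pose Nn n := (s n * (D n).+1)%N.
pose b n := (1 + (Nn n * (Nn n).+1 + Nn n * Nn n * (Nn n).+1))%N.
(* With at most b gates per layer, X bounds the vertices belonging to one level: b copies of [S],
   and gq interior vertices on each of the 2 b^2 paths to the next level. *)
pose X n := (b n * #|S| + 2 * b n * b n * gq cmax)%N.
pose j n := up_log 2 (D n).+1.
(* The second summand provides the depth required by [layered_of_slp], the first makes 2^L at least
   X. Both are logarithmic, so m = 2^L is polynomially bounded. *)
pose L n := (up_log 2 (X n) + (6 * j n).+2)%N.
have Pc := polyb_const.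
have PS1 t : polyb t -> polyb (fun n => (t n).+1) by apply: polyb_add (Pc 1%N).
have PDS : polyb (fun n => (D n).+1) by apply: PS1.
have PN : polyb Nn by apply: polyb_mul.
have PNS := PS1 _ PN.
have Pb : polyb b.
  by apply: polyb_add (Pc 1%N) _; apply: polyb_add; repeat apply: polyb_mul.
have PX : polyb X.
  apply: polyb_add; first exact: polyb_mul Pb (Pc _).
  by repeat apply: polyb_mul.
exists (fun n => 2 ^ L n)%N; split.
  apply: poly_bounded_of_polyb.
  apply: (@polyb_le _ (fun n => 2 ^ up_log 2 (X n) * (4 * (2 ^ j n) ^ 6))%N) => [n|].
    by rewrite /= /L expnD leq_mul // -[(6 * j n).+2]addn2 expnD [(6 * _)%N]mulnC expnM mulnC.
  apply: polyb_mul; first exact: polyb_exp2_up_log.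
  by apply: polyb_mul (Pc _) _; apply: polyb_exp; apply: polyb_exp2_up_log.
move=> n /=; have -> : pow2up (2 ^ L n) = (2 ^ L n)%N by rewrite /pow2up up_expnK.
have [prog [sz cp]] := Hprog n.
have [||q Lq <-] := @layered_of_slp F _ prog _ (D n) (j n) (L n) cp (leqnSn _).
- exact: up_logP.
- by rewrite /L -[X in (_ < X)%N]addnC ltn_addr.
apply: (layered_projection s0 s1 s2 gd (None : lstate _) Lq).
have cI := card_lstate_le (D n) sz; rewrite -/(Nn n) -/(b n) in cI.
have XL : (X n <= 2 ^ L n)%N.
  by apply: leq_trans (@up_logP 2 (X n) isT) _; rewrite leq_exp2l // leq_addr.
have LL : (L n < 2 ^ L n)%N by apply: ltn_expl.
rewrite card_sum !card_prod card_bool !card_ord.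
set c := #|_| in cI *.
(* The L + 1 <= 2^L levels have at most X <= 2^L vertices each, so the target fits into m^2 <= m^6
   vertices. *)
apply: (@leq_trans (2 ^ L n * X n)).
  rewrite /X mulnDr; apply: leq_add; first by rewrite -mulnA !leq_mul.
  by rewrite !mulnA leq_mul // !leq_mul // ltnW.
apply: (@leq_trans (2 ^ L n * 2 ^ L n)); first by rewrite leq_mul.
by rewrite mulnn leq_pexp2l ?expn_gt0.
Qed.

End Completeness.

Local Close Scope ring_scope.

Theorem theorem4 (F : fieldType)
  (V0 V1 V2 : finType) (e0 : rel V0) (e1 : rel V1) (e2 : rel V2)
  (s0 : simple_graph e0) (s1 : simple_graph e1) (s2 : simple_graph e2)
  (c0 : connected e0) (c1 : connected e1) (c2 : connected e2)
  (r0 : rigid e0) (r1 : rigid e1) (r2 : rigid e2)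
  (i01 : incomparable e0 e1) (i02 : incomparable e0 e2) (i12 : incomparable e1 e2)
  (cmax : nat)
  (hc0 : (#|V0| < cmax)%N) (hc1 : (#|V1| < cmax)%N) (hc2 : (#|V2| < cmax)%N)
  (vl0 vr0 : V0) (vl1 vr1 vp1 : V1) (vl2 vr2 vp2 : V2)
  (d0 : vl0 != vr0)
  (d1 : [&& vl1 != vr1, vl1 != vp1 & vr1 != vp1])
  (d2 : [&& vl2 != vr2, vl2 != vp2 & vr2 != vp2]) :
  VP_complete
    (@PFam F (fun n => #|{: 'I_(pow2up n ^ 6) * 'I_(pow2up n ^ 6)}|)
       (fun n => hom_poly F
                   (@GE V0 V1 V2 e0 e1 e2 vl0 vr0 vl1 vr1 vp1 vl2 vr2 vp2 cmax (pow2up n))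
                   (@KE (pow2up n ^ 6)))).
Proof.
have gd := gadgets_gS s0 s1 s2 c0 c1 c2 r0 r1 r2 i01 i02 i12 hc0 hc1 hc2 d0 d1 d2.
by split=> [|f]; [exact: hom_poly_in_VP | exact: hom_poly_VP_hard].
Qed.
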